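(* Let $I=(-1,1)$ and let $*_{\mathtt a}$ be the convolution on $L^2_{\mathbb{C}}(I)$ associated to the Hilbert basis $e_k(x)=\frac1{\sqrt2}e^{i\pi(k+\frac12)x}$, $k\in\mathbb{Z}$, i.e. $C*_{\mathtt a}u=\sum_{k\in\mathbb{Z}}\langle e_k|C\rangle\langle e_k|u\rangle e_k$. Then for all $C,u\in L^2_{\mathbb{C}}(I)$ and $x\in I$ $$(C*_{\mathtt a}u)(x)=\frac1{\sqrt2}\int_{-1}^1\hat C_{\mathtt a}(x-y)\,u(y)\,dy ,$$ where $\hat C_{\mathtt a}$ denotes the extension of $C$ to a $2$-antiperiodic function on $\mathbb{R}$, i.e. $\hat C_{\mathtt a}(x+2)=-\hat C_{\mathtt a}(x)$.
   Context: $\langle g|h\rangle=\int_{-1}^1g^*(y)h(y)\,dy$ with $^*$ complex conjugation. The value $(C*_{\mathtt a}u)(x)$ is the sum of the (absolutely convergent) series $\sum_{k\in\mathbb{Z}}\langle e_k|C\rangle\langle e_k|u\rangle e_k(x)$. The $e_k$ are the normalized eigenfunctions of $-\frac1{\pi^2}\frac{d^2}{dx^2}$ on $I$ with antiperiodic boundary conditions. *)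

(* Defs.v *)
From HB Require Import structures.
From mathcomp Require Export all_boot all_order all_algebra.
From mathcomp Require Export all_classical all_reals all_analysis.
From mathcomp Require Export complex.
From mathcomp Require Import ring lra.
From mathcomp.analysis.showcase Require summability.
Set Implicit Arguments.
Unset Strict Implicit.
Unset Printing Implicit Defensive.
Export Order.TTheory GRing.Theory Num.Theory.
Export numFieldNormedType.Exports.
Global Open Scope classical_set_scope.
Global Open Scope ring_scope.
Global Open Scope complex_scope.

Section ComplexIntegral.
Context (R : realType).
Implicit Types (D : set R) (f : R -> R[i]).

Definition cmeasurable D f : Prop :=
  measurable_fun D (fun y => complex.Re (f y)) /\
  measurable_fun D (fun y => complex.Im (f y)).

Definition cintegrable D f : Prop :=
  (@lebesgue_measure R).-integrable D (fun y => (complex.Re (f y))%:E) /\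
  (@lebesgue_measure R).-integrable D (fun y => (complex.Im (f y))%:E).

Definition cintegral D f : R[i] :=
  (\int[@lebesgue_measure R]_(y in D) complex.Re (f y)) +i*
  (\int[@lebesgue_measure R]_(y in D) complex.Im (f y)).

End ComplexIntegral.

Section ConvolutionI.
Context (R : realType).
Implicit Types (f g h C u : R -> R[i]) (e : int -> R -> R[i]).

Definition Idom : set R := `]-1, 1[.

(* A class in L^2(I; C) is given by any of its representatives; these are total
   functions on R whose values outside I are never used. *)
Definition L2I f : Prop :=
  cmeasurable Idom f /\
  (\int[@lebesgue_measure R]_(y in Idom) (ComplexField.Normc.normc (f y) ^+ 2)%:E
     < +oo)%E.

Definition innerI g h : R[i] := cintegral Idom (fun y => (g y)^* * h y).

Definition conv_term e C u (x : R) (k : int) : R[i] :=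
  innerI (e k) C * innerI (e k) u * e k x.

Definition abs_summable (a : int -> R[i]) : Prop :=
  summable setT (fun k => (ComplexField.Normc.normc (a k))%:E).

(* The limit of the sums over finite sets of indices, ordered by inclusion;
   R[i]^o carries the topology of the complex modulus. *)
Definition csum (a : int -> R[i]) : R[i] :=
  @summability.sum int R[i] R[i]^o a.

Definition conv e C u (x : R) : R[i] := csum (conv_term e C u x).

Definition expi (t : R) : R[i] := cos t +i* sin t.

Definition anti_basis (k : int) (x : R) : R[i] :=
  ((Num.sqrt 2)^-1)%:C * expi (pi * (k%:~R + 2^-1) * x).

(* The values of C on the open interval I determine Ch off the odd integers; at
   the odd integers, a null set, Ch is only constrained by antiperiodicity. *)
Definition antiperiodic_extension C (Ch : R -> R[i]) : Prop :=
  {in Idom, Ch =1 C} /\ forall x : R, Ch (x + 2) = - Ch x.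

Lemma antiperiodic_extension_exists C :
  exists Ch : R -> R[i], antiperiodic_extension C Ch.
Proof.
pose n (x : R) : int := Num.floor ((x + 1) / 2).
exists (fun x => (-1) ^ (n x) * C (x - 2 * (n x)%:~R)); split=> [x|x].
  rewrite inE /Idom /= in_itv/= => /andP[xl xr].
  have -> : n x = 0 by apply: Num.Theory.floor_def; apply/andP; split; lra.
  by rewrite expr0z mul1r mulr0z mulr0 subr0.
have -> : n (x + 2) = n x + 1.
  have /andP[nl nr] := Num.Theory.floor_itv ((x + 1) / 2).
  apply: Num.Theory.floor_def; rewrite -/(n x) in nl nr.
  by apply/andP; split; move: nl nr; rewrite !intrD; lra.
rewrite exprzDr ?unitrN1// expr1z mulrN1 mulNr; congr (- (_ * C _)).
by rewrite intrD; ring.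
Qed.

End ConvolutionI.

(* Main.v *)
(** Fix [x] and put [g(y) = conj (Ch (x - y))].  Since [z |-> Ch z * e_k (x - z)] is
    2-periodic, its integral over a period may be computed on [I], which gives
    [<g|e_k> = sqrt 2 * <e_k|C> * e_k(x)].  The formula is then Parseval's identity
    [<g|u> = sum_k <g|e_k><e_k|u>], and the absolute convergence is Bessel's inequality.

    Parseval's identity rests on the density of the trigonometric sums in L^2.  Call
    a bounded function a multiplier if multiplication by it preserves the closure of the
    trigonometric sums.  By dominated convergence the multipliers are an algebra closed
    under bounded pointwise limits.  It contains [cos (pi y)] and [sin (pi y)], hence
    [q(y) = cos (pi y / 2) sin (pi (y - a) / 2)], which has the sign of [y - a] on [I], hence
    the sign of [q] (a limit of polynomials in [q]), so the indicators of half-lines; the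
    sets with multiplier indicator form a sigma-algebra, so all bounded measurable
    functions are multipliers. *)

Require Import Defs.
From mathcomp Require Import ring lra measurable_realfun.
From mathcomp Require finmap.
Set Implicit Arguments.
Unset Strict Implicit.
Unset Printing Implicit Defensive.

(** * Integration of periodic functions *)

Section Shift.
Context (R : realType).
Notation mu := (@lebesgue_measure R).
Notation I := (@Idom R).

(** By uniqueness of Lebesgue measure it is enough to compare lengths on []a, b]], whose preimage is
    [[c - b, c - a[]. *)
Lemma lebesgue_measure_reflect (c : R) (A : set R) : measurable A ->
  pushforward mu ((fun y => c - y) : _ -> measurableTypeR R) A = mu A.
Proof.
have mphi : measurable_fun [set: measurableTypeR R]
    ((fun y => c - y) : _ -> measurableTypeR R).
  by apply: measurable_funB => //; exact: measurable_id.
move=> mA.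
have H := @lebesgue_measure_unique R
  (measure_function_pushforward__canonical__measure_function_Measure mu mphi).
rewrite /= in H.
apply/esym/H => //= _ [[a b]] _ <-.
rewrite /pushforward.
have -> : (fun y => c - y) @^-1` `]a, b] = `[c - b, c - a[%classic.
  by apply/seteqP; split => y /=; rewrite !in_itv/= => /andP[? ?];
    apply/andP; split; lra.
rewrite !lebesgue_measure_itv/= !lte_fin ltrD2l ltrN2; case: ifP => // _.
by rewrite -!EFinD; congr EFin; ring.
Qed.

Lemma ge0_integral_reflect (c : R) (f : R -> \bar R) :
  measurable_fun [set: R] f -> (forall y, 0 <= f y)%E ->
  (\int[mu]_y f (c - y)%R = \int[mu]_y f y)%E.
Proof.
move=> mf f0.
have mphi : measurable_fun [set: measurableTypeR R]
    ((fun y => c - y) : _ -> measurableTypeR R).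
  by apply: measurable_funB => //; exact: measurable_id.
rewrite -[LHS](@ge0_integral_pushforward _ _ _ _ R _ mphi mu setT)//.
by apply: eq_measure_integral => A mA _; exact: lebesgue_measure_reflect.
Qed.

Lemma measurable_reflect (c : R) d (T : measurableType d) (f : R -> T) :
  measurable_fun [set: R] f -> measurable_fun [set: R] (fun y => f (c - y)).
Proof.
move=> mf; have mphi : measurable_fun [set: R] (fun y : R => c - y).
  by apply: measurable_funB => //; exact: measurable_id.
exact: (measurableT_comp mf mphi).
Qed.

(** Half-open periods: their translates by multiples of 2 tile the line without overlap. [K] is the
    reflection of [J]. *)
Let J : set R := `]-1, 1].
Let K : set R := `[-1, 1[.

(** Exactly one of [w], [w - 2], [w + 2] lies in [J], so at most one summand is nonzero, and
    periodicity identifies it with [F w]. This writes [F] through its zero extension off [J], which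
    is measurable on the whole line. *)
Lemma periodic_translates (F : R -> \bar R) (w : R) :
  (forall z, F (z + 2) = F z) -> -3 < w <= 3 ->
  (F w = (F \_ J) w + (F \_ J) (w - 2)%R + (F \_ J) (w + 2)%R)%E.
Proof.
move=> Fp /andP[w3 w3'].
have Fm z : F (z - 2) = F z by rewrite -(Fp (z - 2)) subrK.
rewrite /patch /J !mem_setE !in_itv/= Fm Fp.
have [a1|a1] := ltP (-1) w; have [a2|a2] := leP w 1;
have [a3|a3] := ltP (-1) (w - 2); have [a4|a4] := leP (w - 2) 1;
have [a5|a5] := ltP (-1) (w + 2); have [a6|a6] := leP (w + 2) 1;
 rewrite /= ?adde0 ?add0e//; exfalso; lra.
Qed.

(** The same tiling seen from the other variable: exactly one of the three translates of [x - z]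
    lies in [K]. *)
Lemma indicK_translates (x z : R) : x \in I -> z \in J ->
  \1_K (x - z) + \1_K (x + 2 - z) + \1_K (x - 2 - z) = 1 :> R.
Proof.
rewrite !inE /= /Idom /J /= !in_itv/= => /andP[? ?] /andP[? ?].
rewrite !indicE /K !mem_setE !in_itv/=.
have [a1|a1] := ltP (x - z) 1; have [a2|a2] := leP (-1) (x - z);
have [a3|a3] := ltP (x + 2 - z) 1; have [a4|a4] := leP (-1) (x + 2 - z);
have [a5|a5] := ltP (x - 2 - z) 1; have [a6|a6] := leP (-1) (x - 2 - z);
 rewrite /= ?addr0 ?add0r//; exfalso; lra.
Qed.

Lemma measurable_Idom : measurable I. Proof. exact: measurable_itv. Qed.

Lemma measurable_periodic (F : R -> \bar R) : measurable_fun I F ->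
  measurable_fun [set: R] (F \_ J).
Proof.
move=> mF; have mJ : measurable J by exact: measurable_itv.
have mFJ : measurable_fun ([set: R] `&` J) F.
  by rewrite setTI; exact: ((emeasurable_fun_itv_bndo_bndcP _ _ _).1 mF).
exact: ((measurable_restrict F mJ measurableT).1 mFJ).
Qed.

(** For [x] and [y] in [I] the point [x - y] lies in []-2, 2[] and may leave [I], where [F] is
    controlled by periodicity only; hence the three reflected translates in [G]. *)
Lemma measurable_periodic_reflect (F : R -> \bar R) (x : R) : x \in I ->
  measurable_fun I F -> (forall z, F (z + 2) = F z) ->
  measurable_fun I (fun y => F (x - y)).
Proof.
rewrite inE /= /Idom /= in_itv/= => /andP[? ?] mF Fp.
pose G y := ((F \_ J) (x - y)%R + (F \_ J) (x - 2 - y)%R + (F \_ J) (x + 2 - y)%R)%E.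
have mG : measurable_fun I G.
  apply: measurable_funTS; apply: emeasurable_funD; [apply: emeasurable_funD|];
    exact: (measurable_reflect _ (measurable_periodic mF)).
refine (eq_measurable_fun _ _ mG) => y; rewrite inE /Idom /= in_itv/= => /andP[? ?].
rewrite /G (_ : x - 2 - y = x - y - 2); last by ring.
rewrite (_ : x + 2 - y = x - y + 2); last by ring.
by rewrite -periodic_translates//; apply/andP; split; lra.
Qed.

(** The integral is unfolded into three integrals over the whole line, each is reflected, and the
    resulting indicators are summed to one on [J]. *)
Lemma ge0_integral_periodic_reflect (F : R -> \bar R) (x : R) : x \in I ->
  measurable_fun I F -> (forall z, F (z + 2) = F z) -> (forall z, 0 <= F z)%E ->
  (\int[mu]_(y in I) F (x - y)%R = \int[mu]_(y in I) F y)%E.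
Proof.
move=> xI mF Fp F0.
have F'0 z : (0 <= (F \_ J) z)%E by rewrite /patch; case: ifP.
have mF' := measurable_periodic mF.
have mKs : measurable K by exact: measurable_itv.
have mK : measurable_fun [set: R] (\1_K : R -> R).
  by apply: measurable_indic; exact: mKs.
have mKr c : measurable_fun [set: R] (fun z => (\1_K (c - z) : R)%:E).
  have := measurable_reflect c mK; by move/measurable_EFinP.
have K0 z : (0 <= (\1_K z : R)%:E)%E by rewrite lee_fin.
(* Adding one endpoint changes neither integral: the left one is taken over [K], the right one over
   [J]. *)
rewrite -(@integral_itv_bndoo R (-1) 1 _ true true); last first.
  exact: measurable_periodic_reflect.
rewrite -[RHS](@integral_itv_bndoo R (-1) 1 _ false false)//.
transitivity (\int[mu]_y ((F \_ J) (x - y)%R * (\1_K y)%:E +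
   (F \_ J) (x + 2 - y)%R * (\1_K y)%:E + (F \_ J) (x - 2 - y)%R * (\1_K y)%:E))%E.
  rewrite integral_mkcond; apply: eq_integral => y _.
  rewrite {1}/patch indicE; case: ifPn => [|_]; last by rewrite !mule0 !adde0.
  rewrite inE /K /= in_itv/= => /andP[? ?].
  move: xI; rewrite inE /= /Idom /= in_itv/= => /andP[? ?].
  rewrite !mule1 (_ : x - 2 - y = x - y - 2); last by ring.
  rewrite (_ : x + 2 - y = x - y + 2); last by ring.
  by rewrite addeAC -periodic_translates//; apply/andP; split; lra.
have mR c : measurable_fun [set: R] (fun y => (F \_ J) (c - y)%R * (\1_K y)%:E)%E.
  by apply: emeasurable_funM; [exact: (measurable_reflect _ mF')|exact/measurable_EFinP].
(* Reflecting about [c] moves the translation from [F] to the indicator of [K]. *)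
have E c : (\int[mu]_y ((F \_ J) (c - y)%R * (\1_K y)%:E) =
    \int[mu]_y ((F \_ J) y * (\1_K (c - y)%R)%:E))%E.
  rewrite -(@ge0_integral_reflect c (fun z => (F \_ J) z * (\1_K (c - z)%R)%:E)%E).
  - by apply: eq_integral => y _; rewrite subKr.
  - exact: emeasurable_funM.
  - by move=> y; exact: mule_ge0.
have D3 (f g h : R -> \bar R) : measurable_fun [set: R] f ->
    measurable_fun [set: R] g -> measurable_fun [set: R] h ->
    (forall y, 0 <= f y)%E -> (forall y, 0 <= g y)%E -> (forall y, 0 <= h y)%E ->
    (\int[mu]_y (f y + g y + h y) =
     \int[mu]_y f y + \int[mu]_y g y + \int[mu]_y h y)%E.
  move=> mf mg mh f0 g0 h0; rewrite ge0_integralD//; last 2 first.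
  - by move=> y _; exact: adde_ge0.
  - exact: emeasurable_funD.
  by rewrite ge0_integralD.
have mE c : measurable_fun [set: R] (fun y => (F \_ J) y * (\1_K (c - y)%R)%:E)%E.
  exact: emeasurable_funM.
have P0 c y : (0 <= (F \_ J) (c - y)%R * (\1_K y)%:E)%E by exact: mule_ge0.
have Q0 c y : (0 <= (F \_ J) y * (\1_K (c - y)%R)%:E)%E by exact: mule_ge0.
rewrite D3// !E -D3//.
rewrite [RHS]integral_mkcond; apply: eq_integral => z _.
have [zJ|zJ] := boolP (z \in J); last by rewrite /patch (negbTE zJ) !mul0e !adde0.
rewrite -!ge0_muleDr ?adde_ge0// -!EFinD.
by rewrite (indicK_translates xI zJ) mule1.
Qed.

Lemma integral_periodic_reflect (F : R -> \bar R) (x : R) : x \in I ->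
  measurable_fun I F -> (forall z, F (z + 2) = F z) ->
  (\int[mu]_(y in I) F (x - y)%R = \int[mu]_(y in I) F y)%E.
Proof.
move=> xI mF Fp; rewrite integralE [RHS]integralE; congr (_ - _)%E.
- rewrite -(@ge0_integral_periodic_reflect F^\+%E x)//.
  + by apply: eq_integral => y _; rewrite !funeposE.
  + exact: measurable_funepos.
  + by move=> z; rewrite !funeposE Fp.
- rewrite -(@ge0_integral_periodic_reflect F^\-%E x)//.
  + by apply: eq_integral => y _; rewrite !funenegE.
  + exact: measurable_funeneg.
  + by move=> z; rewrite !funenegE Fp.
Qed.

End Shift.

(** * Trigonometric sums *)

Section SignIteration.
Context (R : realType).

(** The Newton-Schulz step for the sign: an odd cubic with fixed points -1, 0 and 1, whose
    derivative vanishes at -1 and 1. *)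
Definition sign_step (t : R) : R := (3 * t - t ^+ 3) / 2.

Lemma sign_stepN t : sign_step (- t) = - sign_step t.
Proof. by rewrite /sign_step; field. Qed.

Lemma iter_sign_stepN n t : iter n sign_step (- t) = - iter n sign_step t.
Proof. by elim: n => //= n ->; rewrite sign_stepN. Qed.

(** A step from [u] increases it and multiplies the distance to 1 by [1 - u / 2 - u ^+ 2 / 2], which
    is at most [1 - t / 2] because the iterates stay above [t]. This geometric rate is crude but
    suffices for convergence. *)
Lemma iter_sign_step_itv n t : 0 < t <= 1 ->
  t <= iter n sign_step t <= 1 /\ 1 - iter n sign_step t <= (1 - t / 2) ^+ n.
Proof.
move=> /andP[t0 t1]; elim: n => [|n []] /=.
  by rewrite expr0 lexx t1; split=> //; lra.
set u := iter n _ _ => /andP[tu u1] IH; rewrite /sign_step.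
have u0 : 0 <= u by lra.
have E1 : u <= (3 * u - u ^+ 3) / 2.
  rewrite -subr_ge0 (_ : _ - u = u * (1 - u) * (1 + u) / 2); last by field.
  by rewrite divr_ge0// !mulr_ge0//; lra.
have E2 : (3 * u - u ^+ 3) / 2 <= 1.
  rewrite -subr_ge0 (_ : 1 - _ = (1 - u) ^+ 2 * (2 + u) / 2); last by field.
  by rewrite divr_ge0// mulr_ge0// ?sqr_ge0//; lra.
split; first by rewrite (le_trans tu).
rewrite (_ : 1 - _ = (1 - u) * (1 - u / 2 - u ^+ 2 / 2)); last by field.
rewrite [leRHS]exprSr; apply: ler_pM => //; first by lra.
  have : u ^+ 2 <= 1 by rewrite expr_le1.
  by lra.
have := sqr_ge0 u; lra.
Qed.

Lemma iter_sign_step_norm n t : `|t| <= 1 -> `|iter n sign_step t| <= 1.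
Proof.
move=> t1; have [t0|t0|->] := ltgtP t 0.
- have /iter_sign_step_itv : 0 < - t <= 1 by rewrite oppr_gt0 t0 -(ltr0_norm t0).
  move=> /(_ n)[/andP[]]; rewrite iter_sign_stepN => a b _.
  rewrite -normrN ger0_norm//; lra.
- have /iter_sign_step_itv : 0 < t <= 1 by rewrite t0 -(gtr0_norm t0).
  by move=> /(_ n)[/andP[a b] _]; rewrite ger0_norm//; lra.
- have -> : iter n sign_step 0 = 0.
    by elim: n => //= n ->; rewrite /sign_step; field.
  by rewrite normr0.
Qed.

Lemma cvg_iter_sign_step t : `|t| <= 1 ->
  (fun n => iter n sign_step t) @ \oo --> Num.sg t.
Proof.
have pos s : 0 < s <= 1 -> (fun n => iter n sign_step s) @ \oo --> (1 : R).
  move=> s01; have /andP[s0 s1] := s01.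
  have geo : (fun n => 1 - (1 - s / 2) ^+ n : R) @ \oo --> (1 : R).
    rewrite -[X in _ --> X]subr0; apply: cvgB; first exact: cvg_cst.
    apply: cvg_expr; rewrite ger0_norm; lra.
  apply: (squeeze_cvgr _ geo); last exact: cvg_cst.
  apply: nearW => n; have [/andP[a ->]] := iter_sign_step_itv n s01.
  by rewrite andbT; lra.
move=> t1; have [t0|t0|->] := ltgtP t 0.
- have n01 : 0 < - t <= 1 by rewrite oppr_gt0 t0 -(ltr0_norm t0).
  rewrite ltr0_sg// (_ : (fun n => _) = fun n => - iter n sign_step (- t)).
    exact: cvgN (pos _ n01).
  by apply/funext => n; rewrite iter_sign_stepN opprK.
- by rewrite gtr0_sg//; apply: pos; rewrite t0 -(gtr0_norm t0).
- have E n : iter n sign_step 0 = 0.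
    by elim: n => //= n ->; rewrite /sign_step; field.
  by rewrite sgr0; under eq_fun do rewrite E; exact: cvg_cst.
Qed.

End SignIteration.

(** * Complex exponentials and shifts of the basis *)

Section Expi.
Context (R : realType).

Lemma expiD (a b : R) : expi (a + b) = expi a * expi b.
Proof. by rewrite /expi cosD sinD; simpc; congr Complex; ring. Qed.

Lemma conj_expi (a : R) : (expi a)^* = expi (- a).
Proof. by rewrite /expi cosN sinN. Qed.

Lemma expi0 : expi (0 : R) = 1.
Proof. by rewrite /expi cos0 sin0. Qed.

Lemma anti_basis_shift (k : int) (x : R) :
  anti_basis (k + 1) x = anti_basis k x * expi (pi * x).
Proof.
rewrite /anti_basis -[RHS]mulrA -expiD; congr (_ * expi _).
by rewrite intrD; ring.
Qed.

Lemma anti_basis_shiftN (k : int) (x : R) :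
  anti_basis (k - 1) x = anti_basis k x * expi (- (pi * x)).
Proof.
rewrite /anti_basis -[RHS]mulrA -expiD; congr (_ * expi _).
by rewrite intrD; ring.
Qed.

End Expi.

Section Trigonometric.
Context (R : realType).
Implicit Types P Q : R -> R.

(** The function is real-valued but the coefficients are complex. An index may occur several times
    in the list, so that a sum of functions is a concatenation of lists. *)
Definition trigonometric P := exists s : seq (int * R[i]),
  forall y, (P y)%:C = \sum_(p <- s) p.2 * anti_basis p.1 y.

Lemma trigonometricD P Q : trigonometric P -> trigonometric Q ->
  trigonometric (fun y => P y + Q y).
Proof.
by move=> [s sP] [t tQ]; exists (s ++ t) => y; rewrite big_cat/= -sP -tQ rmorphD.
Qed.

Lemma trigonometricZ c P : trigonometric P -> trigonometric (fun y => c * P y).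
Proof.
move=> [s sP]; exists [seq (p.1, c%:C * p.2) | p <- s] => y.
rewrite big_map/= rmorphM/= sP mulr_sumr.
by apply: eq_bigr => p _; rewrite mulrA.
Qed.

(** Multiplication by [expi (pi * y)] or its inverse shifts the index by one, so the half-integer
    frequencies are preserved. *)
Lemma trigonometricM (f : R -> R) (c d : R[i]) P :
  (forall y, (f y)%:C = c * expi (pi * y) + d * expi (- (pi * y))) ->
  trigonometric P -> trigonometric (fun y => f y * P y).
Proof.
move=> fE [s sP].
exists ([seq (p.1 + 1, c * p.2) | p <- s] ++ [seq (p.1 - 1, d * p.2) | p <- s]).
move=> y; rewrite big_cat/= !big_map/= -big_split/= rmorphM/= sP mulr_sumr.
apply: eq_bigr => p _; rewrite fE anti_basis_shift anti_basis_shiftN; ring.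
Qed.

Lemma trigonometric_cos P :
  trigonometric P -> trigonometric (fun y => cos (pi * y) * P y).
Proof.
apply: (@trigonometricM _ (2^-1)%:C (2^-1)%:C) => y.
by rewrite /expi cosN sinN; simpc; congr Complex; field.
Qed.

Lemma trigonometric_sin P :
  trigonometric P -> trigonometric (fun y => sin (pi * y) * P y).
Proof.
apply: (@trigonometricM _ (0 -i* 2^-1) (0 +i* 2^-1)) => y.
by rewrite /expi cosN sinN; simpc; congr Complex; field.
Qed.

(** The frequencies 1/2 and -1/2 are the indices 0 and -1; the coefficient [sqrt 2 / 2] is the 1/2
    of Euler's formula times the inverse of the normalization. *)
Lemma trigonometric_half_cos : trigonometric (fun y => cos (pi / 2 * y)).
Proof.
pose c : R[i] := (Num.sqrt 2 / 2)%:C.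
exists [:: (0, c); (-1, c)] => y.
have s2 : Num.sqrt 2 != 0 :> R by rewrite sqrtr_eq0 -ltNge.
rewrite !big_cons big_nil addr0 /= /anti_basis /expi.
rewrite (_ : pi * ((-1)%:~R + 2^-1) * y = - (pi / 2 * y)); last by field.
rewrite (_ : pi * (0%:~R + 2^-1) * y = pi / 2 * y); last by field.
by rewrite cosN sinN /c; simpc; congr Complex; field.
Qed.

End Trigonometric.

(** * Square-integrable real functions *)

Section RealL2.
Context (R : realType).
Notation mu := (@lebesgue_measure R).
Notation I := (@Idom R).
Implicit Types f g h P : R -> R.

Definition sqnorm f : \bar R := (\int[mu]_(y in I) ((f y) ^+ 2)%:E)%E.

Definition square_integrable f := measurable_fun I f /\ (sqnorm f < +oo)%E.

Let mI : measurable I := @measurable_Idom R.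

Lemma measurable_sqr f : measurable_fun I f ->
  measurable_fun I (fun y => ((f y) ^+ 2)%:E).
Proof. by move=> mf; apply/measurable_EFinP; exact: measurable_funX. Qed.

Lemma sqnorm_ge0 f : (0 <= sqnorm f)%E.
Proof. by apply: integral_ge0 => y _; rewrite lee_fin sqr_ge0. Qed.

Lemma le_sqnorm f g : measurable_fun I f -> measurable_fun I g ->
  (forall y, I y -> `|f y| <= `|g y|) -> (sqnorm f <= sqnorm g)%E.
Proof.
move=> mf mg fg; apply: ge0_le_integral => //.
- by move=> y _; rewrite lee_fin sqr_ge0.
- exact: measurable_sqr.
- exact: measurable_sqr.
- move=> y /fg H; rewrite lee_fin -(real_normK (num_real (f y))).
  by rewrite -(real_normK (num_real (g y))) lerXn2r ?nnegrE.
Qed.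

Lemma eq_sqnorm f g : (forall y, I y -> f y = g y) -> sqnorm f = sqnorm g.
Proof. by move=> fg; apply: eq_integral => y; rewrite inE => /fg ->. Qed.

Lemma sqnormZ c f : measurable_fun I f ->
  sqnorm (fun y => c * f y) = ((c ^+ 2)%:E * sqnorm f)%E.
Proof.
move=> mf; rewrite /sqnorm -ge0_integralZl_EFin ?sqr_ge0//.
- by apply: eq_integral => y _; rewrite exprMn EFinM.
- by move=> y _; rewrite lee_fin sqr_ge0.
- exact: measurable_sqr.
Qed.

(** Pointwise, the right side minus the left side is [(f y - g y) ^+ 2]. This replaces the triangle
    inequality and keeps square roots out. *)
Lemma sqnormD_le f g : measurable_fun I f -> measurable_fun I g ->
  (sqnorm (fun y => f y + g y)%R <= 2%:E * sqnorm f + 2%:E * sqnorm g)%E.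
Proof.
move=> mf mg; rewrite /sqnorm -!ge0_integralZl_EFin//; last 4 first.
  all: try by move=> y _; rewrite lee_fin sqr_ge0.
  all: try exact: measurable_sqr.
have m2 h : measurable_fun I h -> measurable_fun I (fun y => (2%:E * ((h y) ^+ 2)%:E)%E).
  by move=> mh; apply: emeasurable_funM => //; exact: measurable_sqr.
have p2 h y : (0 <= 2%:E * ((h y) ^+ 2)%:E :> \bar R)%E.
  by rewrite -EFinM lee_fin mulr_ge0// sqr_ge0.
rewrite -ge0_integralD//; [|exact: m2|exact: m2].
apply: ge0_le_integral => //.
- by move=> y _; rewrite lee_fin sqr_ge0.
- by apply: measurable_sqr; exact: measurable_funD.
- by apply: emeasurable_funD; exact: m2.
move=> y _; rewrite -!EFinM -EFinD lee_fin -subr_ge0.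
rewrite (_ : _ - _ = (f y - g y) ^+ 2); last by ring.
exact: sqr_ge0.
Qed.

Lemma sqnormD_lt f g (e : R) : measurable_fun I f -> measurable_fun I g ->
  (sqnorm f < (e / 4)%R%:E)%E -> (sqnorm g < (e / 4)%R%:E)%E ->
  (sqnorm (fun y => f y + g y)%R < e%:E)%E.
Proof.
move=> mf mg fe ge; apply: (le_lt_trans (sqnormD_le mf mg)).
rewrite (_ : e%:E = 2%:E * (e / 4)%R%:E + 2%:E * (e / 4)%R%:E)%E; last first.
  by rewrite -!EFinM -EFinD; congr EFin; field.
by apply: lteD; rewrite lte_pmul2l.
Qed.

Lemma square_integrable_le f g : measurable_fun I f -> square_integrable g ->
  (forall y, I y -> `|f y| <= `|g y|) -> square_integrable f.
Proof.
move=> mf [mg gi] fg; split=> //; apply: le_lt_trans gi; exact: le_sqnorm.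
Qed.

Lemma square_integrableD f g : square_integrable f -> square_integrable g ->
  square_integrable (fun y => f y + g y).
Proof.
move=> [mf fi] [mg gi]; split; first exact: measurable_funD.
apply: (le_lt_trans (sqnormD_le mf mg)).
by rewrite lte_add_pinfty// lte_mul_pinfty// sqnorm_ge0.
Qed.

Lemma square_integrableZ c f : square_integrable f ->
  square_integrable (fun y => c * f y).
Proof.
move=> [mf fi]; split; first exact: measurable_funM.
by rewrite sqnormZ// lte_mul_pinfty// ?lee_fin sqr_ge0.
Qed.

Lemma square_integrableP f :
  square_integrable f <-> measurable_fun I f /\
    mu.-integrable I (fun y => ((f y) ^+ 2)%:E).
Proof.
split=> -[mf fi]; split=> //.
  apply/integrableP; split; first exact: measurable_sqr.
  under eq_integral do rewrite gee0_abs ?lee_fin ?sqr_ge0//.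
  exact: fi.
case/integrableP : fi => _.
by under eq_integral do rewrite gee0_abs ?lee_fin ?sqr_ge0//.
Qed.

Lemma bounded_square_integrable f B : measurable_fun I f ->
  (forall y, I y -> `|f y| <= B) -> square_integrable f.
Proof.
move=> mf fB; apply: (@square_integrable_le _ (cst B)) => //.
- split; first exact: measurable_cst.
  rewrite (_ : sqnorm _ = ((B ^+ 2)%:E * mu I)%E); last by rewrite -integral_cst.
  rewrite lte_mul_pinfty// ?lee_fin ?sqr_ge0//.
  by rewrite /I lebesgue_measure_itv/=; case: ifP => _; rewrite ltry.
- by move=> y /fB H; rewrite /cst/= (le_trans H)// ler_norm.
Qed.

Lemma cvg_norm_le (v : nat -> R) (l b : R) :
  v @ \oo --> l -> (forall n, `|v n| <= b) -> `|l| <= b.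
Proof.
move=> /cvg_norm vl vb; have := cvg_lim (@Rhausdorff R) vl => <-.
apply: limr_le; last exact: nearW.
by apply/cvg_ex; exists `|l|.
Qed.

(** Dominated convergence applied to [(f - f_ n) ^+ 2], with the integrable majorant
    [(2 * g) ^+ 2]. *)
Lemma dominated_sqnorm_lt (f_ : nat -> R -> R) f g (e : R) : 0 < e ->
  (forall n, measurable_fun I (f_ n)) -> measurable_fun I f ->
  square_integrable g -> (forall n y, I y -> `|f_ n y| <= g y) ->
  (forall y, I y -> (fun n => f_ n y) @ \oo --> f y) ->
  exists n, (sqnorm (fun y => f y - f_ n y)%R < e%:E)%E.
Proof.
move=> e0 mf_ mf g2 fg fcvg.
have fg' y : I y -> `|f y| <= g y.
  by move=> Iy; apply: (cvg_norm_le (fcvg _ Iy)) => n; exact: fg.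
have [_ ig] := (square_integrableP _).1 (square_integrableZ 2 g2).
have := @dominated_cvg _ _ R mu I mI (fun n y => ((f y - f_ n y) ^+ 2)%:E)
  (cst 0%E) (fun y => ((2 * g y) ^+ 2)%:E).
move=> /(_ _ _ _ ig)H.
have {H} : (fun n => sqnorm (fun y => f y - f_ n y)) @ \oo --> 0%E.
  rewrite -[X in _ --> X](integral0 mu I); apply: H => //.
  - by move=> n; apply: measurable_sqr; exact: measurable_funB.
  - move=> y Iy; have hc : (fun n => (f y - f_ n y) ^+ 2) @ \oo --> (0 : R).
      rewrite (_ : 0 = (f y - f y) * (f y - f y)); last by rewrite subrr mulr0.
      by apply: cvgM; apply: cvgB; try exact: cvg_cst; exact: fcvg.
    rewrite /cst; apply: cvg_EFin; first by apply: nearW.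
    exact: hc.
  - move=> n y Iy; rewrite gee0_abs ?lee_fin ?sqr_ge0//.
    rewrite -(real_normK (num_real (_ - _))) lerXn2r ?nnegrE//.
      by rewrite mulr_ge0// (le_trans _ (fg' _ Iy)).
    by rewrite (le_trans (ler_normB _ _))// mulr2n mulrDl !mul1r lerD// ?fg ?fg'.
(* Convergence to 0 in the extended reals gives eventual finiteness and convergence of the real
   values; one index satisfying both is picked. *)
move=> /fine_cvgP[fn /cvgrPdist_lt/(_ _ e0) he].
have [n [/fineK E hn]] : exists n, sqnorm (fun y => f y - f_ n y) \is a fin_num /\
    `|0 - fine (sqnorm (fun y => f y - f_ n y))| < e.
  by have [n _ hn] := filterI fn he; exists n; have := hn n (leqnn n).
exists n; rewrite -E lte_fin; apply: le_lt_trans hn.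
by rewrite sub0r normrN ler_norm.
Qed.

End RealL2.

(** * Density of trigonometric sums *)

Section Density.
Context (R : realType).
Notation I := (@Idom R).
Implicit Types f g h P phi psi : R -> R.

(** The closure in real [L^2] of the trigonometric sums, expressed with the squared norm. *)
Definition trig_approx f := square_integrable f /\
  forall e : R, 0 < e -> exists P, [/\ trigonometric P, measurable_fun I P &
    (sqnorm (fun y => f y - P y)%R < e%:E)%E].

Lemma trigonometric_trig_approx P : trigonometric P -> square_integrable P ->
  trig_approx P.
Proof.
move=> tP P2; split=> // e e0; exists P; split=> //; first exact: P2.1.
rewrite (@eq_sqnorm _ _ (fun y => 0 * P y)); last by move=> y _; rewrite subrr mul0r.
by rewrite sqnormZ ?expr0n ?mul0e ?lte_fin//; exact: P2.1.
Qed.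

Lemma eq_trig_approx f g : (forall y, I y -> f y = g y) ->
  trig_approx f -> trig_approx g.
Proof.
move=> fg [[mf f2] fa]; split.
  split; last by rewrite -(eq_sqnorm fg).
  by apply: (eq_measurable_fun f) => // y; rewrite inE; exact: fg.
move=> e /fa[P [tP mP Pe]]; exists P; split=> //.
by rewrite -(@eq_sqnorm _ (fun y => f y - P y))// => y /fg ->.
Qed.

Lemma trig_approxD f g : trig_approx f -> trig_approx g ->
  trig_approx (fun y => f y + g y).
Proof.
move=> [f2 fa] [g2 ga]; split; first exact: square_integrableD.
move=> e e0; have e40 : 0 < e / 4 by rewrite divr_gt0.
have [P [tP mP Pe]] := fa _ e40; have [Q [tQ mQ Qe]] := ga _ e40.
exists (fun y => P y + Q y); split; [exact: trigonometricD|exact: measurable_funD|].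
rewrite (@eq_sqnorm _ _ (fun y => (f y - P y) + (g y - Q y))); last first.
  by move=> y _; ring.
by apply: sqnormD_lt => //; apply: measurable_funB => //; [exact: f2.1|exact: g2.1].
Qed.

Lemma trig_approx_closed f : square_integrable f ->
  (forall e : R, 0 < e -> exists2 g, trig_approx g &
     (sqnorm (fun y => f y - g y)%R < e%:E)%E) ->
  trig_approx f.
Proof.
move=> f2 fa; split=> // e e0; have e40 : 0 < e / 4 by rewrite divr_gt0.
have [g [g2 ga] ge] := fa _ e40; have [P [tP mP Pe]] := ga _ e40.
exists P; split=> //.
rewrite (@eq_sqnorm _ _ (fun y => (f y - g y) + (g y - P y))); last first.
  by move=> y _; ring.
by apply: sqnormD_lt => //; apply: measurable_funB => //; [exact: f2.1|exact: g2.1|exact: g2.1].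
Qed.

(** Pointwise convergence under a square-integrable majorant is convergence in [L^2], and the
    closure is closed. *)
Lemma trig_approx_dominated (f_ : nat -> R -> R) f g :
  (forall n, trig_approx (f_ n)) -> square_integrable g ->
  (forall n y, I y -> `|f_ n y| <= g y) ->
  (forall y, I y -> (fun n => f_ n y) @ \oo --> f y) ->
  trig_approx f.
Proof.
move=> fa g2 fg fcvg.
have mf_ n : measurable_fun I (f_ n) by have [[]] := fa n.
have mf : measurable_fun I f by exact: (measurable_fun_cvg mf_).
have fg' y : I y -> `|f y| <= `|g y|.
  move=> Iy; apply: (cvg_norm_le (fcvg _ Iy)) => n.
  by rewrite (le_trans (fg n _ Iy))// ler_norm.
apply: trig_approx_closed; first exact: square_integrable_le g2 fg'.
move=> e e0; have [n hn] := dominated_sqnorm_lt e0 mf_ mf g2 fg fcvg.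
by exists (f_ n).
Qed.

Definition bounded_multiplier phi := [/\ measurable_fun I phi,
  (exists B, forall y, I y -> `|phi y| <= B) &
  forall f, trig_approx f -> trig_approx (fun y => phi y * f y)].

Lemma eq_bounded_multiplier phi psi : (forall y, I y -> phi y = psi y) ->
  bounded_multiplier phi -> bounded_multiplier psi.
Proof.
move=> e [mphi [B hB] ha]; split.
- by apply: (eq_measurable_fun phi) => // y; rewrite inE; exact: e.
- by exists B => y Iy; rewrite -e// hB.
- by move=> f /ha; apply: eq_trig_approx => y Iy; rewrite e.
Qed.

Lemma bounded_multiplier_cst c : bounded_multiplier (fun=> c).
Proof.
split; first exact: measurable_cst.
  by exists `|c|.
move=> f [f2 fa]; split; first exact: square_integrableZ.
(* The added 1 allows the division also when [c = 0]. *)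
move=> e e0; have c0 : 0 < c ^+ 2 + 1 by have := sqr_ge0 c; lra.
have [P [tP mP Pe]] := fa _ (divr_gt0 e0 c0).
exists (fun y => c * P y); split; [exact: trigonometricZ|exact: measurable_funM|].
rewrite (@eq_sqnorm _ _ (fun y => c * (f y - P y))); last by move=> y _; ring.
have mfP : measurable_fun I (fun y => f y - P y).
  by apply: measurable_funB => //; exact: f2.1.
rewrite sqnormZ//; apply: (@le_lt_trans _ _ ((c ^+ 2 + 1)%:E * sqnorm (fun y => f y - P y)%R)%E).
  by rewrite lee_wpmul2r ?sqnorm_ge0// lee_fin; lra.
by rewrite -lte_pdivlMl// -EFinM mulrC.
Qed.

Lemma bounded_multiplierD phi psi : bounded_multiplier phi ->
  bounded_multiplier psi -> bounded_multiplier (fun y => phi y + psi y).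
Proof.
move=> [mp [B hB] pa] [mq [D hD] qa]; split; first exact: measurable_funD.
  by exists (B + D) => y Iy; rewrite (le_trans (ler_normD _ _))// lerD ?hB ?hD.
move=> f fa; apply: (eq_trig_approx _ (trig_approxD (pa _ fa) (qa _ fa))) => y _.
by rewrite mulrDl.
Qed.

Lemma bounded_multiplierM phi psi : bounded_multiplier phi ->
  bounded_multiplier psi -> bounded_multiplier (fun y => phi y * psi y).
Proof.
move=> [mp [B hB] pa] [mq [D hD] qa]; split; first exact: measurable_funM.
  by exists (B * D) => y Iy; rewrite normrM ler_pM ?hB ?hD.
move=> f fa; apply: (eq_trig_approx _ (pa _ (qa _ fa))) => y _.
by rewrite mulrA.
Qed.

(** The products [phi_ n * f] have the common square-integrable majorant [B * |f|]. *)
Lemma bounded_multiplier_cvg (phi_ : nat -> R -> R) phi B :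
  (forall n, bounded_multiplier (phi_ n)) ->
  (forall n y, I y -> `|phi_ n y| <= B) ->
  (forall y, I y -> (fun n => phi_ n y) @ \oo --> phi y) ->
  bounded_multiplier phi.
Proof.
move=> pa pB pcvg.
have mp n : measurable_fun I (phi_ n) by have [] := pa n.
have mphi : measurable_fun I phi by exact: (measurable_fun_cvg mp).
split=> //.
  by exists B => y Iy; apply: (cvg_norm_le (pcvg _ Iy)) => n; exact: pB.
move=> f fa; apply: (@trig_approx_dominated (fun n y => phi_ n y * f y) _
    (fun y => B * `|f y|)).
- by move=> n; have [_ _] := pa n; exact.
- apply: square_integrableZ; apply: (@square_integrable_le _ _ f) => //.
  + by apply: measurableT_comp => //; exact: fa.1.1.
  + exact: fa.1.
  + by move=> y _; rewrite normr_id.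
- by move=> n y Iy; rewrite normrM ler_wpM2r ?pB.
- by move=> y Iy; apply: cvgM; [exact: pcvg|exact: cvg_cst].
Qed.

(** A factor of modulus at most 1 does not increase the squared norm, so [phi * P] approximates
    [phi * f] at least as well as [P] approximates [f]. *)
Lemma bounded_multiplier_trig phi : measurable_fun I phi ->
  (forall y, I y -> `|phi y| <= 1) ->
  (forall P, trigonometric P -> trigonometric (fun y => phi y * P y)) ->
  bounded_multiplier phi.
Proof.
move=> mphi phi1 tphi; split=> //; first by exists 1.
move=> f [f2 fa].
have le1 g : measurable_fun I g -> forall y, I y -> `|phi y * g y| <= `|g y|.
  by move=> _ y /phi1 H; rewrite normrM ler_piMl.
split.
  apply: square_integrable_le (f2) _; last by apply: le1; exact: f2.1.
  by apply: measurable_funM => //; exact: f2.1.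
move=> e /fa[P [tP mP Pe]]; exists (fun y => phi y * P y).
have mfP : measurable_fun I (fun y => f y - P y).
  by apply: measurable_funB => //; exact: f2.1.
split; [exact: tphi|exact: measurable_funM|].
apply: le_lt_trans Pe.
rewrite (@eq_sqnorm _ _ (fun y => phi y * (f y - P y))); last by move=> y _; ring.
apply: le_sqnorm => //; first exact: measurable_funM.
exact: (le1 (fun y => f y - P y)).
Qed.

Lemma measurable_cosM c : measurable_fun I (fun y => cos (c * y)).
Proof.
apply: measurable_funTS; apply: measurableT_comp.
  by apply: continuous_measurable_fun; exact: continuous_cos.
by apply: measurable_funM.
Qed.

Lemma measurable_sinM c : measurable_fun I (fun y => sin (c * y)).
Proof.
apply: measurable_funTS; apply: measurableT_comp.
  by apply: continuous_measurable_fun; exact: continuous_sin.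
by apply: measurable_funM.
Qed.

Lemma bounded_multiplier_cos : bounded_multiplier (fun y => cos (pi * y)).
Proof.
apply: bounded_multiplier_trig => [|y _|]; first exact: measurable_cosM.
- by rewrite ler_norml cos_geN1 cos_le1.
- exact: trigonometric_cos.
Qed.

Lemma bounded_multiplier_sin : bounded_multiplier (fun y => sin (pi * y)).
Proof.
apply: bounded_multiplier_trig => [|y _|]; first exact: measurable_sinM.
- by rewrite ler_norml sin_geN1 sin_le1.
- exact: trigonometric_sin.
Qed.

End Density.

(** * From trigonometric multipliers to all bounded measurable functions *)

Section BoundedMeasurable.
Context (R : realType).
Notation I := (@Idom R).
Implicit Types f g h P phi psi : R -> R.
Let mI : measurable I := @measurable_Idom R.

Lemma bounded_multiplier_sg phi : bounded_multiplier phi ->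
  (forall y, I y -> `|phi y| <= 1) -> bounded_multiplier (fun y => Num.sg (phi y)).
Proof.
move=> mphi phi1.
apply: (@bounded_multiplier_cvg _ (fun n y => iter n (@sign_step R) (phi y)) _ 1).
- elim=> [|n IH] //=.
  (* With [u] the previous iterate, the step is [(3 / 2 - u * u / 2) * u]. *)
  apply: eq_bounded_multiplier (bounded_multiplierM
    (bounded_multiplierD (bounded_multiplier_cst (3 / 2)) (bounded_multiplierM
      (bounded_multiplier_cst (- 2^-1)) (bounded_multiplierM IH IH))) IH) => y _.
  by rewrite /sign_step; field.
- by move=> n y /phi1; exact: iter_sign_step_norm.
- by move=> y /phi1; exact: cvg_iter_sign_step.
Qed.

Lemma Idom_itv y : I y -> -1 < y < 1.
Proof. by rewrite /Idom /= in_itv. Qed.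

Lemma half_cos_gt0 y : I y -> 0 < cos (pi / 2 * y).
Proof.
move=> /Idom_itv/andP[y0 y1]; have p0 := pi_gt0 R.
have q0 : 0 < (pi : R) / 2 by lra.
by apply: cos_gt0_pihalf; apply/andP; split; nra.
Qed.

(** The bounds on [a] keep [pi / 2 * (y - a)] in []-pi, pi[] for [y] in [I], where the sine has the
    sign of its argument. *)
Lemma bounded_multiplier_half_line_in a : -1 <= a <= 1 ->
  bounded_multiplier (\1_(`]a, +oo[%classic) : R -> R).
Proof.
move=> /andP[a0 a1].
pose q y : R := cos (pi / 2 * y) * sin (pi / 2 * (y - a)).
have q1 y : I y -> `|q y| <= 1.
  move=> _; rewrite /q normrM -[leRHS]mulr1 ler_pM// ler_norml.
    by rewrite cos_geN1 cos_le1.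
  by rewrite sin_geN1 sin_le1.
have qm : bounded_multiplier q.
  (* The factors of [q] are antiperiodic or worse, but the double-angle formulas turn their product
     into [(cos b * sin (pi * y) - sin b * cos (pi * y) - sin b) / 2]. *)
  pose b := pi / 2 * a.
  apply: eq_bounded_multiplier (bounded_multiplierD
    (bounded_multiplierM (bounded_multiplier_cst (cos b / 2)) (bounded_multiplier_sin R))
    (bounded_multiplierD
      (bounded_multiplierM (bounded_multiplier_cst (- sin b / 2)) (bounded_multiplier_cos R))
      (bounded_multiplier_cst (- sin b / 2)))) => y _.
  rewrite /q mulrBr -/b (_ : pi * y = (pi / 2 * y) *+ 2); last by rewrite mulr2n; field.
  by rewrite sin_mulr2n cos_mulr2n sinB; field.
have sm := bounded_multiplier_sg qm q1.
(* For a sign [s] in {-1, 0, 1}, the number [(s + s * s) / 2] is 1 if [s = 1] and 0 otherwise, which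
   also settles the point [y = a]. *)
apply: eq_bounded_multiplier (bounded_multiplierM (bounded_multiplier_cst 2^-1)
  (bounded_multiplierD sm (bounded_multiplierM sm sm))) => y Iy.
have c0 := half_cos_gt0 Iy; have /andP[y0 y1] := Idom_itv Iy; have p0 := pi_gt0 R.
rewrite indicE mem_setE in_itv/= andbT /q; case: ltP => ya.
  rewrite gtr0_sg; first by rewrite /=; field.
  by rewrite mulr_gt0// sin_gt0_pi//; apply/andP; split; nra.
have : sin (pi / 2 * (y - a)) <= 0.
  rewrite -oppr_ge0 -sinN sin_ge0_pi//; apply/andP; split; nra.
rewrite sgrM (gtr0_sg c0) mul1r le_eqVlt => /predU1P[->|s0].
  by rewrite sgr0 !mulr0 addr0 mulr0.
by rewrite ltr0_sg//= mulrNN mulr1 addNr mulr0.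
Qed.

(** For [a] outside [[-1, 1]] the indicator is constant on [I]. *)
Lemma bounded_multiplier_half_line a :
  bounded_multiplier (\1_(`]a, +oo[%classic) : R -> R).
Proof.
have [a0|a0] := ltP a (-1).
  apply: eq_bounded_multiplier (bounded_multiplier_cst 1) => y /Idom_itv/andP[? ?].
  by rewrite indicE mem_setE in_itv/= andbT (lt_trans a0).
have [a1|a1] := leP a 1; first by apply: bounded_multiplier_half_line_in; rewrite a0.
apply: eq_bounded_multiplier (bounded_multiplier_cst 0) => y /Idom_itv/andP[? ?].
by rewrite indicE mem_setE in_itv/= andbT ltNge ltW// (lt_trans _ a1).
Qed.

Lemma bounded_multiplier_prod (phi_ : nat -> R -> R) n :
  (forall k, bounded_multiplier (phi_ k)) ->
  bounded_multiplier (fun y => \prod_(k < n) phi_ k y).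
Proof.
move=> pm; elim: n => [|n IH].
  by apply: eq_bounded_multiplier (bounded_multiplier_cst 1) => y _; rewrite big_ord0.
apply: eq_bounded_multiplier (bounded_multiplierM IH (pm n)) => y _.
by rewrite big_ord_recr.
Qed.

Lemma bounded_multiplier_sum (T : Type) (s : seq T) (phi_ : T -> R -> R) :
  (forall k, bounded_multiplier (phi_ k)) ->
  bounded_multiplier (fun y => \sum_(k <- s) phi_ k y).
Proof.
move=> pm; elim: s => [|k s IH].
  by apply: eq_bounded_multiplier (bounded_multiplier_cst 0) => y _; rewrite big_nil.
by apply: eq_bounded_multiplier (bounded_multiplierD (pm k) IH) => y _; rewrite big_cons.
Qed.

(** The indicator of the complement of the union is the limit of the finite products of
    [1 - \1_(A k)]. At a point of some [A k] the products vanish as soon as [n > k]; elsewhere they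
    all equal 1. *)
Lemma bounded_multiplier_bigcup (A : nat -> set R) :
  (forall n, bounded_multiplier (\1_(A n) : R -> R)) ->
  bounded_multiplier (\1_(\bigcup_n A n) : R -> R).
Proof.
move=> Am; have Bm k : bounded_multiplier (fun y => 1 - \1_(A k) y : R).
  apply: eq_bounded_multiplier (bounded_multiplierD (bounded_multiplier_cst 1)
    (bounded_multiplierM (bounded_multiplier_cst (-1)) (Am k))) => y _.
  by rewrite mulN1r.
pose Q n y : R := \prod_(k < n) (1 - \1_(A k) y).
have B01 k y : 0 <= (1 - \1_(A k) y : R) <= 1.
  by rewrite indicE; case: (_ \in _) => /=; lra.
have Q01 n y : 0 <= Q n y <= 1.
  rewrite /Q prodr_ge0 => [|k _]; last by have /andP[] := B01 k y.
  by by apply: prodr_ile1 => k _; exact: B01.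
apply: (@bounded_multiplier_cvg _ (fun n y => 1 - Q n y) _ 1).
- move=> n; apply: eq_bounded_multiplier (bounded_multiplierD (bounded_multiplier_cst 1)
    (bounded_multiplierM (bounded_multiplier_cst (-1)) (bounded_multiplier_prod n Bm))) => y _.
  by rewrite mulN1r.
- by move=> n y _; have /andP[? ?] := Q01 n y; rewrite ger0_norm; lra.
move=> y _; rewrite indicE; case: (boolP (y \in _)) => [|yA].
  rewrite inE => -[k _ Ak]; apply: cvg_near_cst; near=> n.
  have kn : (k < n)%N by near: n; exact: nbhs_infty_gt.
  rewrite /Q (bigD1 (Ordinal kn))//= indicE mem_set//=.
  by rewrite subrr mul0r subr0.
rewrite (_ : (fun n => _) = fun=> 0); first exact: cvg_cst.
apply/funext => n; rewrite /Q big1 ?subrr// => k _.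
rewrite indicE memNset ?subr0// => Ak; move/negP: yA; apply.
by rewrite inE; exists k.
Unshelve. all: by end_near. Qed.

Lemma bounded_multiplier_indic (A : set R) : measurable A ->
  bounded_multiplier (\1_A : R -> R).
Proof.
move=> mA; have : (@RGenOInfty.G R).-sigma.-measurable A.
  by rewrite -RGenOInfty.measurableE.
apply: (@smallest_sub _ _ _ [set B | bounded_multiplier (\1_B : R -> R)]).
- split => /=.
  + by apply: eq_bounded_multiplier (bounded_multiplier_cst 0) => y _; rewrite indic0.
  + move=> B mB; apply: eq_bounded_multiplier (bounded_multiplierD (bounded_multiplier_cst 1)
      (bounded_multiplierM (bounded_multiplier_cst (-1)) mB)) => y _.
    by rewrite setTD mulN1r !indicE in_setC; case: (y \in B); rewrite /= ?subrr ?subr0.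
  + exact: bounded_multiplier_bigcup.
- by move=> _ [a ->]; exact: bounded_multiplier_half_line.
Qed.

Import HBNNSimple.

Lemma bounded_multiplier_nnsfun (phi : {nnsfun R >-> R}) : bounded_multiplier phi.
Proof.
pose F r y : R := r * \1_(phi @^-1` [set r]) y.
apply: eq_bounded_multiplier (@bounded_multiplier_sum _
   (finmap.enum_fset (fset_set (range phi))) F _) => [y _|r].
  rewrite fimfunE fsbig_finite//.
by apply: bounded_multiplierM; [exact: bounded_multiplier_cst|exact: bounded_multiplier_indic].
Qed.

Lemma bounded_multiplier_bounded phi B : measurable_fun I phi ->
  (forall y, I y -> `|phi y| <= B) -> bounded_multiplier phi.
Proof.
move=> mphi phiB.
(* The shift makes the function nonnegative, so that it is the limit of simple functions lying below
   it, hence bounded by [2 * B]. *)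
pose psi y : R := phi y + B.
have psi0 y : I y -> 0 <= psi y <= 2 * B.
  by move=> /phiB; rewrite ler_norml => /andP[? ?]; rewrite /psi; apply/andP; split; lra.
have mpsi : measurable_fun I (EFin \o psi).
  by apply/measurable_EFinP; apply: measurable_funD.
have psi0' y : I y -> (0 <= (EFin \o psi) y)%E by move=> /psi0/andP[]; rewrite lee_fin.
have H : bounded_multiplier psi.
  apply: (@bounded_multiplier_cvg _ (fun n => nnsfun_approx mI mpsi n) _ (2 * B)).
  - by move=> n; exact: bounded_multiplier_nnsfun.
  - move=> n y Iy; rewrite ger0_norm//.
    have /andP[_] := psi0 _ Iy; apply: le_trans.
    have := le_approx n psi0' Iy; rewrite lee_fin.
    by rewrite -(nnsfun_approxE mI mpsi).
  - move=> y Iy; have := cvg_nnsfun_approx mI mpsi psi0' Iy.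
    by move=> /fine_cvgP[_].
apply: eq_bounded_multiplier (bounded_multiplierD H (bounded_multiplier_cst (- B))) => y _.
by rewrite /psi addrK.
Qed.

(* The constant is recovered from the antiperiodic [w = cos (pi y / 2) > 0], as the limit
   of [1 - (1 - w)^n], a bounded measurable multiple of [w]. *)
Lemma trig_approx_cst1 : trig_approx (fun=> 1 : R).
Proof.
pose w y : R := cos (pi / 2 * y).
have w01 y : I y -> 0 <= 1 - w y < 1.
  move=> /half_cos_gt0; have := cos_le1 (pi / 2 * y); rewrite /w; lra.
have mw : measurable_fun I w by exact: measurable_cosM.
have wa : trig_approx w.
  apply: trigonometric_trig_approx; first exact: trigonometric_half_cos.
  by apply: (bounded_square_integrable mw (B := 1)) => y _; rewrite ler_norml cos_geN1 cos_le1.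
apply: (@trig_approx_dominated _ (fun n y => 1 - (1 - w y) ^+ n) _ (fun=> 1)).
- move=> n; pose v y : R := \sum_(i < n) (1 - w y) ^+ i.
  have mv : measurable_fun I v.
    apply: measurable_sum => i; apply: measurable_funX.
    by apply: measurable_funB => //; exact: measurable_cst.
  have [_ _ vm] : bounded_multiplier v.
    apply: (bounded_multiplier_bounded (B := n%:R)) => // y /w01 /andP[w0 w1].
    apply: (le_trans (ler_norm_sum _ _ _)).
    rewrite (_ : n%:R = \sum_(i < n) (1 : R)); last by rewrite sumr_const card_ord.
    apply: ler_sum => i _; rewrite normrX ger0_norm// exprn_ile1// ltW//.
  apply: (eq_trig_approx _ (vm _ wa)) => y _.
  have := subrX1 (1 - w y) n; rewrite -/(v y) => E.
  by rewrite -opprB E; ring.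
- apply: (bounded_square_integrable (B := 1)); first exact: measurable_cst.
  by move=> y _; rewrite normr1.
- move=> n y /w01/andP[w0 w1].
  have a : (1 - w y) ^+ n <= 1 by rewrite exprn_ile1// ltW.
  have b : 0 <= (1 - w y) ^+ n by rewrite exprn_ge0.
  by rewrite ger0_norm; lra.
- move=> y /w01/andP[w0 w1]; rewrite -[X in _ --> X]subr0.
  by apply: cvgB; [exact: cvg_cst|apply: cvg_expr; rewrite ger0_norm].
Qed.

(** The truncation [F n] of [f] to [[-n, n]] is a multiplier applied to the constant 1. It is
    dominated by [|f|], and at each point it equals [f] for large [n]. *)
Lemma square_integrable_trig_approx f : square_integrable f -> trig_approx f.
Proof.
move=> f2; pose F n y : R := Num.min n%:R (Num.max (- n%:R) (f y)).
apply: (@trig_approx_dominated _ F _ (fun y => `|f y|)).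
- move=> n; have [_ _ Fm] : bounded_multiplier (F n).
    apply: (bounded_multiplier_bounded (B := n%:R)).
      apply: measurable_minr; first exact: measurable_cst.
      by apply: measurable_maxr; [exact: measurable_cst|exact: f2.1].
    move=> y _; rewrite /F ler_norml ge_min lexx/= le_min le_max lexx/= andbT.
    by rewrite (le_trans (y := 0)) ?oppr_le0.
  by apply: eq_trig_approx (Fm _ trig_approx_cst1) => y _; rewrite mulr1.
- apply: (@square_integrable_le _ _ f) => //; last by move=> y _; rewrite normr_id.
  by apply: measurableT_comp => //; exact: f2.1.
- move=> n y _; rewrite /F ler_norml.
  have n0 : 0 <= n%:R :> R by [].
  have := ler_norm (f y); have := ler_norm (- f y); rewrite normrN => ? ?.
  have := normr_ge0 (f y) => ?.
  rewrite /Num.min /Num.max; case: ifP => A; case: ifP A => B' A; apply/andP; split; lra.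
- move=> y _; apply: cvg_near_cst; near=> n.
  have : `|f y| <= n%:R.
    near: n; exists (Num.truncn `|f y|).+1 => // n /= hn.
    by rewrite (le_trans (ltW (truncnS_gt _)))// ler_nat.
  by rewrite /F ler_norml => /andP[h1 h2]; rewrite max_r// min_r.
Unshelve. all: by end_near. Qed.

End BoundedMeasurable.

(** * The complex inner product *)

Section ComplexL2.
Context (R : realType).
Notation mu := (@lebesgue_measure R).
Notation I := (@Idom R).
Notation normc := ComplexField.Normc.normc.
Notation Re := (@complex.Re R).
Notation Im := (@complex.Im R).
Implicit Types (F G f g h : R -> R[i]) (c z : R[i]).
Let mI : measurable (I : set (measurableTypeR R)) := @measurable_Idom R.

Lemma sqr_normc z : normc z ^+ 2 = Re z ^+ 2 + Im z ^+ 2.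
Proof. by case: z => a b /=; rewrite sqr_sqrtr// addr_ge0// sqr_ge0. Qed.

Lemma normc_ge0 z : 0 <= normc z.
Proof. by case: z => a b; exact: sqrtr_ge0. Qed.

Lemma normcM z c : normc (z * c) = normc z * normc c.
Proof. exact: ComplexField.Normc.normcM. Qed.

Lemma ReM z c : Re (z * c) = Re z * Re c - Im z * Im c.
Proof. by case: z c => ? ? [? ?]. Qed.

Lemma ImM z c : Im (z * c) = Re z * Im c + Im z * Re c.
Proof. by case: z c => ? ? [? ?]. Qed.

Lemma ReD z c : Re (z + c) = Re z + Re c.
Proof. by case: z c => ? ? [? ?]. Qed.

Lemma ImD z c : Im (z + c) = Im z + Im c.
Proof. by case: z c => ? ? [? ?]. Qed.

Lemma ReJ z : Re (conjc z) = Re z.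
Proof. by case: z. Qed.

Lemma ImJ z : Im (conjc z) = - Im z.
Proof. by case: z. Qed.

Lemma conjcD z c : conjc (z + c) = conjc z + conjc c.
Proof. by rewrite rmorphD. Qed.

Lemma conjcM z c : conjc (z * c) = conjc z * conjc c.
Proof. by rewrite rmorphM. Qed.

Lemma cintegralD F G : cintegrable I F -> cintegrable I G ->
  cintegral I (fun y => F y + G y) = cintegral I F + cintegral I G.
Proof.
move=> [F1 F2] [G1 G2]; rewrite /cintegral; simpc; congr Complex.
  by under eq_Rintegral do rewrite ReD; rewrite RintegralD.
by under eq_Rintegral do rewrite ImD; rewrite RintegralD.
Qed.

Lemma Rintegral_lin (a b : R) (p q : R -> R) :
  mu.-integrable I (EFin \o p) -> mu.-integrable I (EFin \o q) ->
  \int[mu]_(y in I) (a * p y + b * q y) =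
  a * \int[mu]_(y in I) p y + b * \int[mu]_(y in I) q y.
Proof.
move=> ip iq; rewrite RintegralD//; last 2 first.
- exact: (integrableZl mI a ip).
- exact: (integrableZl mI b iq).
by rewrite !RintegralZl.
Qed.

Lemma cintegralZ c F : cintegrable I F ->
  cintegral I (fun y => c * F y) = c * cintegral I F.
Proof.
move=> [F1 F2]; rewrite /cintegral [in RHS](_ : c = Re c +i* Im c); last by case: c.
simpc; congr Complex.
  by under eq_Rintegral do rewrite ReM -mulNr; rewrite Rintegral_lin// mulNr.
by under eq_Rintegral do rewrite ImM; rewrite Rintegral_lin.
Qed.

Lemma cintegralJ F : cintegrable I F ->
  cintegral I (fun y => conjc (F y)) = conjc (cintegral I F).
Proof.
move=> [F1 F2]; rewrite /cintegral/=; congr Complex.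
  by apply: eq_Rintegral => y _; rewrite ReJ.
rewrite -mulN1r -RintegralZl//.
by apply: eq_Rintegral => y _; rewrite ImJ mulN1r.
Qed.

Lemma eq_cintegral F G : (forall y, I y -> F y = G y) ->
  cintegral I F = cintegral I G.
Proof.
by move=> FG; rewrite /cintegral; congr Complex; apply: eq_Rintegral => y;
  rewrite inE => /FG ->.
Qed.

Lemma L2IP f : L2I f <->
  square_integrable (fun y => Re (f y)) /\ square_integrable (fun y => Im (f y)).
Proof.
have E : measurable_fun I (fun y => Re (f y)) -> measurable_fun I (fun y => Im (f y)) ->
    (\int[mu]_(y in I) (normc (f y) ^+ 2)%:E =
     sqnorm (fun y => Re (f y)) + sqnorm (fun y => Im (f y)))%E.
  move=> m1 m2; rewrite -ge0_integralD//; last 4 first.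
  - by move=> y _; rewrite lee_fin sqr_ge0.
  - exact: measurable_sqr.
  - by move=> y _; rewrite lee_fin sqr_ge0.
  - exact: measurable_sqr.
  by apply: eq_integral => y _; rewrite sqr_normc.
split=> [[[m1 m2]]|[[m1 s1] [m2 s2]]].
  rewrite E// => s; split; split=> //; apply: le_lt_trans s.
    by rewrite leeDl// sqnorm_ge0.
  by rewrite leeDr// sqnorm_ge0.
by split; [split|rewrite E// lte_add_pinfty].
Qed.

(** The majorant is [p ^+ 2 + q ^+ 2], as seen from the squares of [p + q] and [p - q]. *)
Lemma integrable_mul (p q : R -> R) : square_integrable p -> square_integrable q ->
  mu.-integrable I (EFin \o (fun y => p y * q y)).
Proof.
move=> p2 q2; have [mp ip] := (square_integrableP _).1 p2.
have [mq iq] := (square_integrableP _).1 q2.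
apply: le_integrable (integrableD mI ip iq) => //.
  by apply/measurable_EFinP; exact: measurable_funM.
move=> y _ /=; rewrite lee_fin [leRHS]ger0_norm ?addr_ge0 ?sqr_ge0// ler_norml.
have := sqr_ge0 (p y + q y); have := sqr_ge0 (p y - q y).
by move=> ? ?; apply/andP; split; nra.
Qed.

Lemma cintegrableM f g : L2I f -> L2I g -> cintegrable I (fun y => f y * g y).
Proof.
move=> /L2IP[f1 f2] /L2IP[g1 g2]; split.
  under eq_fun do rewrite ReM.
  exact: (integrableB mI (integrable_mul f1 g1) (integrable_mul f2 g2)).
under eq_fun do rewrite ImM.
exact: (integrableD mI (integrable_mul f1 g2) (integrable_mul f2 g1)).
Qed.

Lemma L2ID f g : L2I f -> L2I g -> L2I (fun y => f y + g y).
Proof.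
move=> /L2IP[f1 f2] /L2IP[g1 g2]; apply/L2IP; split.
  by under eq_fun do rewrite ReD; exact: square_integrableD.
by under eq_fun do rewrite ImD; exact: square_integrableD.
Qed.

Lemma L2IZ c f : L2I f -> L2I (fun y => c * f y).
Proof.
move=> /L2IP[f1 f2]; apply/L2IP; split.
  by under eq_fun do rewrite ReM -mulNr; apply: square_integrableD;
    exact: square_integrableZ.
by under eq_fun do rewrite ImM; apply: square_integrableD;
  exact: square_integrableZ.
Qed.

Lemma L2IJ f : L2I f -> L2I (fun y => conjc (f y)).
Proof.
move=> /L2IP[f1 f2]; apply/L2IP; split.
  by under eq_fun do rewrite ReJ.
by under eq_fun do rewrite ImJ -mulN1r; exact: square_integrableZ.
Qed.

Lemma L2IB f g : L2I f -> L2I g -> L2I (fun y => f y - g y).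
Proof.
move=> f2 g2; have := L2ID f2 (L2IZ (-1) g2).
by under eq_fun do rewrite mulN1r.
Qed.

Lemma L2I0 : @L2I R (fun=> 0).
Proof.
by apply/L2IP; split => /=; apply: (bounded_square_integrable (B := 0)) => //;
  move=> y _; rewrite normr0.
Qed.

Lemma L2I_sum (T : Type) (s : seq T) (c_ : T -> R[i]) (f_ : T -> R -> R[i]) :
  (forall k, L2I (f_ k)) -> L2I (fun y => \sum_(k <- s) c_ k * f_ k y).
Proof.
move=> f2; elim: s => [|k s IH].
  by under eq_fun do rewrite big_nil; exact: L2I0.
by under eq_fun do rewrite big_cons; apply: L2ID => //; exact: L2IZ.
Qed.

Lemma innerIC f g : L2I f -> L2I g -> innerI g f = conjc (innerI f g).
Proof.
move=> f2 g2; rewrite /innerI -cintegralJ; last exact: cintegrableM (L2IJ f2) g2.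
by apply: eq_cintegral => y _; rewrite rmorphM/= conjcK mulrC.
Qed.

Lemma innerIDr f g h : L2I f -> L2I g -> L2I h ->
  innerI f (fun y => g y + h y) = innerI f g + innerI f h.
Proof.
move=> f2 g2 h2; rewrite /innerI -cintegralD; last 2 first.
- exact: cintegrableM (L2IJ f2) g2.
- exact: cintegrableM (L2IJ f2) h2.
by apply: eq_cintegral => y _; rewrite mulrDr.
Qed.

Lemma innerIZr c f g : L2I f -> L2I g ->
  innerI f (fun y => c * g y) = c * innerI f g.
Proof.
move=> f2 g2; rewrite /innerI -cintegralZ; last exact: cintegrableM (L2IJ f2) g2.
by apply: eq_cintegral => y _; rewrite mulrCA.
Qed.

Lemma innerIDl f g h : L2I f -> L2I g -> L2I h ->
  innerI (fun y => g y + h y) f = innerI g f + innerI h f.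
Proof.
move=> f2 g2 h2; rewrite (innerIC f2 (L2ID g2 h2)) innerIDr// conjcD.
by rewrite -(innerIC f2 g2) -(innerIC f2 h2).
Qed.

Lemma innerIZl c f g : L2I f -> L2I g ->
  innerI (fun y => c * g y) f = conjc c * innerI g f.
Proof.
move=> f2 g2; rewrite (innerIC f2 (L2IZ c g2)) innerIZr// conjcM.
by rewrite -(innerIC f2 g2).
Qed.

Lemma innerIBr f g h : L2I f -> L2I g -> L2I h ->
  innerI f (fun y => g y - h y) = innerI f g - innerI f h.
Proof.
move=> f2 g2 h2; have := innerIDr f2 g2 (L2IZ (-1) h2).
by rewrite innerIZr// mulN1r; under eq_fun do rewrite mulN1r.
Qed.

Lemma innerI_sumr (T : Type) (s : seq T) (c_ : T -> R[i]) (f_ : T -> R -> R[i]) f :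
  L2I f -> (forall k, L2I (f_ k)) ->
  innerI f (fun y => \sum_(k <- s) c_ k * f_ k y) =
  \sum_(k <- s) c_ k * innerI f (f_ k).
Proof.
move=> f2 fk2; elim: s => [|k s IH].
  rewrite big_nil (_ : (fun y => _) = fun y => 0 * f y).
    by rewrite innerIZr// mul0r.
  by apply/funext => y; rewrite big_nil mul0r.
rewrite big_cons -IH -innerIZr// -innerIDr//.
- by congr (innerI f _); apply/funext => y; rewrite big_cons.
- exact: L2IZ.
- exact: L2I_sum.
Qed.

Definition normsq f : R := Re (innerI f f).

Lemma normsqE f : L2I f -> normsq f =
  fine (sqnorm (fun y => Re (f y))) + fine (sqnorm (fun y => Im (f y))).
Proof.
move=> /L2IP[f1 f2]; rewrite /normsq /innerI /cintegral/=.
have [_ i1] := (square_integrableP _).1 f1; have [_ i2] := (square_integrableP _).1 f2.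
rewrite -[RHS]RintegralD//; apply: eq_Rintegral => y _.
by rewrite ReM ReJ ImJ; ring.
Qed.

Lemma normsq_ge0 f : L2I f -> 0 <= normsq f.
Proof. by move=> /normsqE ->; rewrite addr_ge0// fine_ge0// sqnorm_ge0. Qed.

(** By conjugate symmetry the imaginary part equals its opposite. *)
Lemma innerII f : L2I f -> innerI f f = (normsq f)%:C.
Proof.
move=> f2; have := innerIC f2 f2; rewrite /normsq; case: (innerI f f) => a b /= [E].
by congr Complex; lra.
Qed.

Lemma normsqD f g : L2I f -> L2I g ->
  normsq (fun y => f y + g y) = normsq f + normsq g + 2 * Re (innerI f g).
Proof.
move=> f2 g2; have fg2 := L2ID f2 g2; rewrite /normsq.
rewrite innerIDr// !innerIDl// (innerIC f2 g2) !ReD ReJ; ring.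
Qed.

Lemma normsqZ c f : L2I f -> normsq (fun y => c * f y) = normc c ^+ 2 * normsq f.
Proof.
move=> f2; have cf2 := L2IZ c f2.
by rewrite {1}/normsq innerIZr// innerIZl// innerII// sqr_normc !ReM !ImM ReJ ImJ/=; ring.
Qed.

Lemma cauchy_schwarz f g : L2I f -> L2I g ->
  normc (innerI f g) ^+ 2 <= normsq f * normsq g.
Proof.
move=> f2 g2; set z := innerI f g.
(* This is the squared norm of [f - s * conjc z * g]. *)
have key (s : R) : 0 <= normsq f + s ^+ 2 * normc z ^+ 2 * normsq g - 2 * s * normc z ^+ 2.
  pose c : R[i] := (- s)%:C * conjc z.
  have := normsq_ge0 (L2ID f2 (L2IZ c g2)).
  rewrite normsqD//; last exact: L2IZ.
  rewrite normsqZ// innerIZr// -/z !sqr_normc /c !ReM !ImM ReJ ImJ/=.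
  by move=> H; apply: (le_trans H); rewrite le_eqVlt; apply/orP; left; apply/eqP; ring.
have [g0|g0] := leP (normsq g) 0.
  have E : normsq g = 0 by apply/eqP; rewrite eq_le g0 normsq_ge0.
  rewrite E mulr0; have [//|z0] := leP (normc z ^+ 2) 0.
  (* When [normsq g = 0] the bound is affine in [s]; this [s] makes it [-1], a contradiction. *)
  have := key ((normsq f + 1) / (2 * normc z ^+ 2)).
  rewrite E mulr0 addr0 (_ : 2 * _ * _ = normsq f + 1); first by lra.
  have zn : normc z != 0 by apply: contraTneq z0 => ->; rewrite expr0n ltxx.
  by field; rewrite ?zn.
(* The value of [s] that minimizes the quadratic. *)
have := key (normsq g)^-1.
rewrite (_ : _ - _ = (normsq f * normsq g - normc z ^+ 2) / normsq g); last first.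
  by field; rewrite gt_eqF.
by rewrite pmulr_lge0 ?invr_gt0// subr_ge0.
Qed.

End ComplexL2.

(** * Orthonormality of the basis *)

Section AntiBasis.
Context (R : realType).
Notation mu := (@lebesgue_measure R).
Notation I := (@Idom R).
Notation normc := ComplexField.Normc.normc.
Notation Re := (@complex.Re R).
Notation Im := (@complex.Im R).
Notation e_ := (@anti_basis R).
Implicit Types (F G f g h : R -> R[i]) (c : R[i]).
Let mI : measurable (I : set (measurableTypeR R)) := @measurable_Idom R.

Lemma cintegral_periodic_reflect F x : x \in I -> cmeasurable I F ->
  (forall z, F (z + 2) = F z) ->
  cintegral I (fun y => F (x - y)) = cintegral I F.
Proof.
move=> xI [m1 m2] Fp; rewrite /cintegral /Rintegral; congr (Complex (fine _) (fine _)).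
- apply: (@integral_periodic_reflect R (fun y => (Re (F y))%:E)) => //.
    exact/measurable_EFinP.
  by move=> z; rewrite Fp.
- apply: (@integral_periodic_reflect R (fun y => (Im (F y))%:E)) => //.
    exact/measurable_EFinP.
  by move=> z; rewrite Fp.
Qed.

Lemma cmeasurable_periodic_reflect F x : x \in I -> cmeasurable I F ->
  (forall z, F (z + 2) = F z) -> cmeasurable I (fun y => F (x - y)).
Proof.
move=> xI [m1 m2] Fp; split; apply/measurable_EFinP.
- apply: (@measurable_periodic_reflect R (fun y => (Re (F y))%:E)) => //.
    exact/measurable_EFinP.
  by move=> z; rewrite Fp.
- apply: (@measurable_periodic_reflect R (fun y => (Im (F y))%:E)) => //.
    exact/measurable_EFinP.
  by move=> z; rewrite Fp.
Qed.

Lemma cmeasurableM F G : cmeasurable I F -> cmeasurable I G ->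
  cmeasurable I (fun y => F y * G y).
Proof.
move=> [f1 f2] [g1 g2]; split.
  by under eq_fun do rewrite ReM; apply: measurable_funB; exact: measurable_funM.
by under eq_fun do rewrite ImM; apply: measurable_funD; exact: measurable_funM.
Qed.

Lemma sqrtV2 : (Num.sqrt 2)^-1 * (Num.sqrt 2)^-1 = 2^-1 :> R.
Proof. by rewrite -invfM -expr2 sqr_sqrtr. Qed.

Lemma sqrt2_neq0 : Num.sqrt 2 != 0 :> R.
Proof. by rewrite sqrtr_eq0 -ltNge. Qed.

Lemma normc_expi (t : R) : normc (expi t) = 1.
Proof. by rewrite /= cos2Dsin2 sqrtr1. Qed.

Lemma cmeasurable_expiM (a b : R) : cmeasurable I (fun y => expi (a * y + b)).
Proof.
have m : measurable_fun I (fun y : R => a * y + b).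
  by apply: measurable_funD => //; apply: measurable_funM.
split; apply: measurableT_comp => //; apply: continuous_measurable_fun.
  exact: continuous_cos.
exact: continuous_sin.
Qed.

Lemma expi_L2I (a b : R) : L2I (fun y => expi (a * y + b)).
Proof.
have [m1 m2] := cmeasurable_expiM a b; apply/L2IP.
split; apply: (bounded_square_integrable (B := 1)) => // y _.
  by rewrite ler_norml cos_geN1 cos_le1.
by rewrite ler_norml sin_geN1 sin_le1.
Qed.

Lemma cintegrable_expi (a b : R) : cintegrable I (fun y => expi (a * y + b)).
Proof.
have := cintegrableM (expi_L2I 0 0) (expi_L2I a b).
by under eq_fun do rewrite mul0r addr0 expi0 mul1r.
Qed.

Lemma anti_basis_L2I k : L2I (e_ k).
Proof.
apply: L2IZ; have := expi_L2I (pi * (k%:~R + 2^-1)) 0.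
by under eq_fun do rewrite addr0.
Qed.

Lemma conj_anti_basisM k l y : conjc (e_ k y) * e_ l y =
  (2^-1)%:C * expi (pi * (l - k)%:~R * y).
Proof.
rewrite /anti_basis conjcM conjc_real conj_expi mulrACA -rmorphM/= sqrtV2 -expiD.
by congr (_ * expi _); rewrite rmorphB/=; ring.
Qed.

Lemma expi_int_periodic (m : int) (y : R) :
  expi (pi * m%:~R * (y + 2)) = expi (pi * m%:~R * y).
Proof.
rewrite mulrDr expiD (_ : expi (pi * m%:~R * 2) = 1) ?mulr1//.
have E2 : expi (pi *+ 2 : R) = 1 by rewrite /expi cos2pi sin2pi.
have En (n : nat) : expi (pi * n%:R * 2 : R) = 1.
  elim: n => [|n IH]; first by rewrite mulr0 mul0r expi0.
  rewrite (_ : _ * 2 = pi * n%:R * 2 + pi *+ 2); last by rewrite -natr1 mulr2n; ring.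
  by rewrite expiD IH E2 mulr1.
case: m => n; first exact: En.
rewrite NegzE mulrNz mulrN mulNr -conj_expi.
by rewrite (En n.+1) conjc1.
Qed.

(* The mean of a nontrivial character is multiplied by i under translation by a
   quarter of its period, hence vanishes. *)
Lemma cintegral_expi_int (m : int) : m != 0 ->
  cintegral I (fun y => expi (pi * m%:~R * y)) = 0.
Proof.
move=> m0; set F := fun y => _.
have mF : cmeasurable I F.
  have := cmeasurable_expiM (pi * m%:~R) 0.
  by under eq_fun do rewrite addr0.
have Fp z : F (z + 2) = F z by exact: expi_int_periodic.
have mr0 : m%:~R != 0 :> R by rewrite intr_eq0.
pose x : R := (2 * m%:~R)^-1.
have x1 : `|x| < 1.
  rewrite /x normfV normrM ger0_norm// invf_lt1.
    have : (1 : R) <= `|m%:~R| by rewrite -intr_norm (ler_int R 1) -gtz0_ge1 normr_gt0.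
    lra.
  by rewrite mulr_gt0// normr_gt0.
have xI : x \in I by rewrite inE /Idom /= in_itv/= -ltr_norml.
(* The translation is obtained by comparing two reflections, at [0] and at [x], both of which
   preserve the integral over [I]. *)
have zI : (0 : R) \in I by rewrite inE /Idom /= in_itv/=; apply/andP; split; lra.
have := cintegral_periodic_reflect xI mF Fp.
have := cintegral_periodic_reflect zI mF Fp.
set A := cintegral I F => A0 Ax.
have i2 : cintegrable I (fun y => F (0 - y)).
  have := cintegrable_expi (- (pi * m%:~R)) 0.
  by under eq_fun do rewrite addr0 mulNr -mulrN -sub0r.
have : cintegral I (fun y => F (x - y)) = 'i%C * A.
  rewrite -A0 -cintegralZ//; apply: eq_cintegral => y _.
  rewrite /F mulrBr sub0r mulrN expiD; congr (_ * _).
  rewrite (_ : pi * _ * x = pi / 2); last by rewrite /x; field.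
  by rewrite /expi cos_pihalf sin_pihalf.
rewrite Ax; case: A {A0 Ax} => a b; simpc => -[h1 h2].
by congr Complex; lra.
Qed.

Lemma innerI_anti_basis k l : innerI (e_ k) (e_ l) = (k == l)%:R.
Proof.
have E : innerI (e_ k) (e_ l) =
    cintegral I (fun y => (2^-1)%:C * expi (pi * (l - k)%:~R * y)).
  by apply: eq_cintegral => y _; exact: conj_anti_basisM.
have ci m : cintegrable I (fun y : R => expi (pi * m%:~R * y)).
  by have := cintegrable_expi (pi * m%:~R) 0; under eq_fun do rewrite addr0.
rewrite E; have [->|kl] := eqVneq k l.
  rewrite (cintegralZ _ (ci (l - l))) subrr; under eq_fun do rewrite mulr0 mul0r.
  have muI : mu I = (2 : R)%:E.
    rewrite /Idom lebesgue_measure_itv/= lte_fin ifT; last by lra.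
    by rewrite -EFinD; congr EFin; ring.
  rewrite /cintegral /expi/= cos0 sin0 !Rintegral_cst//.
  rewrite mul0r mul1r (_ : fine _ = 2); last exact: (congr1 fine muI).
  by simpc; congr Complex; field.
rewrite (cintegralZ _ (ci (l - k))) cintegral_expi_int ?mulr0//.
by rewrite subr_eq0 eq_sym.
Qed.

End AntiBasis.

(** * Bessel and Parseval *)

Section Parseval.
Context (R : realType).
Notation normc := ComplexField.Normc.normc.
Notation Re := (@complex.Re R).
Notation Im := (@complex.Im R).
Notation e_ := (@anti_basis R).
Implicit Types (F G f g h : R -> R[i]) (c : R[i]) (s : seq int).

Definition fourier_sum s g (y : R) : R[i] := \sum_(k <- s) innerI (e_ k) g * e_ k y.

Lemma fourier_sum_L2I s g : L2I (fourier_sum s g).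
Proof. by apply: L2I_sum => k; exact: anti_basis_L2I. Qed.

Lemma residual_L2I s g : L2I g -> L2I (fun y => g y - fourier_sum s g y).
Proof. by move=> g2; apply: L2IB => //; exact: fourier_sum_L2I. Qed.

Lemma innerI_fourier_sum s g k : uniq s -> k \in s ->
  innerI (e_ k) (fourier_sum s g) = innerI (e_ k) g.
Proof.
move=> us ks; rewrite innerI_sumr; [|exact: anti_basis_L2I|by move=> l; exact: anti_basis_L2I].
rewrite (bigD1_seq k)//= innerI_anti_basis eqxx mulr1 big1 ?addr0// => l lk.
by rewrite innerI_anti_basis eq_sym (negbTE lk) mulr0.
Qed.

(** By orthonormality the coefficients of the residual vanish at every index in [s]. The sum has the
    shape used in [trigonometric], so repeated indices are allowed. *)
Lemma residual_orthogonal s g (t : seq (int * R[i])) : L2I g -> uniq s ->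
  {subset [seq p.1 | p <- t] <= s} ->
  innerI (fun y => g y - fourier_sum s g y)
    (fun y => \sum_(p <- t) p.2 * e_ p.1 y) = 0.
Proof.
move=> g2 us ts; rewrite innerI_sumr; [|exact: residual_L2I|by move=> p; exact: anti_basis_L2I].
rewrite big_seq big1// => p pt.
rewrite (innerIC (anti_basis_L2I R p.1) (residual_L2I s g2)).
rewrite innerIBr ?innerI_fourier_sum ?subrr ?conjc0 ?mulr0//.
- by apply: ts; apply: map_f.
- exact: anti_basis_L2I.
- exact: fourier_sum_L2I.
Qed.

Lemma fourier_sum_pairs s g : fourier_sum s g =
  fun y => \sum_(p <- [seq (k, innerI (e_ k) g) | k <- s]) p.2 * e_ p.1 y.
Proof. by apply/funext => y; rewrite big_map. Qed.

Lemma residual_orthogonal_fourier_sum s g : L2I g -> uniq s ->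
  innerI (fun y => g y - fourier_sum s g y) (fourier_sum s g) = 0.
Proof.
move=> g2 us; rewrite [X in innerI _ X]fourier_sum_pairs residual_orthogonal//.
by move=> k; rewrite -map_comp map_id_in.
Qed.

Lemma normsq_fourier_sum s g : L2I g -> uniq s ->
  normsq (fourier_sum s g) = \sum_(k <- s) normc (innerI (e_ k) g) ^+ 2.
Proof.
move=> g2 us; have S2 := fourier_sum_L2I s g.
rewrite /normsq {2}/fourier_sum innerI_sumr//; last by move=> k; exact: anti_basis_L2I.
rewrite big_seq [RHS]big_seq.
rewrite (eq_bigr (fun k => (normc (innerI (e_ k) g) ^+ 2)%:C)).
  by rewrite -rmorph_sum.
move=> k ks; rewrite (innerIC (anti_basis_L2I R k) S2) innerI_fourier_sum//.
rewrite sqr_normc; case: (innerI _ _) => a b; simpc => /=; congr Complex; ring.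
Qed.

(** Pythagoras for the decomposition of [g] into its residual and its Fourier sum. *)
Lemma bessel s g : L2I g -> uniq s ->
  \sum_(k <- s) normc (innerI (e_ k) g) ^+ 2 <= normsq g.
Proof.
move=> g2 us; rewrite -normsq_fourier_sum//.
have h2 := residual_L2I s g2; have S2 := fourier_sum_L2I s g.
have := normsqD h2 S2; rewrite residual_orthogonal_fourier_sum//= mulr0 addr0.
under eq_fun do rewrite subrK.
by move=> ->; rewrite lerDr normsq_ge0.
Qed.

(** Pythagoras again: the competing error is the residual plus a combination of the [e_ k] with [k]
    in [s], which is orthogonal to it. *)
Lemma best_approximation s g (t : seq (int * R[i])) : L2I g -> uniq s ->
  {subset [seq p.1 | p <- t] <= s} ->
  normsq (fun y => g y - fourier_sum s g y) <=
  normsq (fun y => g y - \sum_(p <- t) p.2 * e_ p.1 y).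
Proof.
move=> g2 us ts; have h2 := residual_L2I s g2; have S2 := fourier_sum_L2I s g.
have P2 : L2I (fun y => \sum_(p <- t) p.2 * e_ p.1 y).
  by apply: L2I_sum => p; exact: anti_basis_L2I.
have D2 := L2IB S2 P2.
have := normsqD h2 D2.
rewrite innerIBr// residual_orthogonal_fourier_sum// residual_orthogonal// subr0 mulr0 addr0.
under eq_fun do rewrite addrA subrK.
by move=> ->; rewrite lerDl normsq_ge0.
Qed.

(** Real and imaginary parts are approximated separately within [e / 2]; the coefficients of the
    second sum are multiplied by i. *)
Lemma L2I_trig_approx g (e : R) : L2I g -> 0 < e ->
  exists t : seq (int * R[i]), normsq (fun y => g y - \sum_(p <- t) p.2 * e_ p.1 y) < e.
Proof.
move=> g2 e0; have /L2IP[r2 i2] := g2.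
have e20 : 0 < e / 2 by rewrite divr_gt0.
have [P [[s sP] mP Pe]] := (square_integrable_trig_approx r2).2 _ e20.
have [Q [[t tQ] mQ Qe]] := (square_integrable_trig_approx i2).2 _ e20.
exists (s ++ [seq (p.1, 'i%C * p.2) | p <- t]).
have E y : \sum_(p <- s ++ [seq (p.1, 'i%C * p.2) | p <- t]) p.2 * e_ p.1 y = P y +i* Q y.
  rewrite big_cat/= -sP big_map/=; under eq_bigr do rewrite -mulrA.
  by rewrite -mulr_sumr -tQ; simpc.
under eq_fun do rewrite E.
have D2 : L2I (fun y => g y - (P y +i* Q y)).
  under eq_fun do rewrite -E; apply: L2IB => //.
  by apply: L2I_sum => p; exact: anti_basis_L2I.
rewrite normsqE// (splitr e).
rewrite (@eq_sqnorm _ _ (fun y => Re (g y) - P y)); last first.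
  by move=> y _; case: (g y).
rewrite (@eq_sqnorm _ (fun y => Im _) (fun y => Im (g y) - Q y)); last first.
  by move=> y _; case: (g y).
have fine_lt (x : \bar R) (r : R) : (0 <= x)%E -> (x < r%:E)%E -> fine x < r.
  by case: x => //= x _; rewrite lte_fin.
by rewrite ltrD// fine_lt// sqnorm_ge0.
Qed.

Lemma residual_lt g (e : R) : L2I g -> 0 < e -> exists s0 : seq int,
  forall s, uniq s -> {subset s0 <= s} ->
  normsq (fun y => g y - fourier_sum s g y) < e.
Proof.
move=> g2 /(L2I_trig_approx g2)[t te]; exists [seq p.1 | p <- t] => s us ts.
exact: le_lt_trans (best_approximation g2 us ts) te.
Qed.

(** The error is the inner product of [f] with the residual of [g], bounded by Cauchy-Schwarz.
    Convergence along finite index sets is phrased with duplicate-free lists containing [s0]. *)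
Lemma parseval f g (e : R) : L2I f -> L2I g -> 0 < e -> exists s0 : seq int,
  forall s, uniq s -> {subset s0 <= s} ->
  normc (innerI f g - \sum_(k <- s) innerI (e_ k) g * innerI f (e_ k)) < e.
Proof.
move=> f2 g2 e0; have N0 := normsq_ge0 f2.
(* Cauchy-Schwarz then bounds the squared error by less than [e ^+ 2]; the 1 guards against
   [normsq f = 0]. *)
have d0 : 0 < e ^+ 2 / (normsq f + 1) by rewrite divr_gt0 ?exprn_gt0//; lra.
have [s0 hs0] := residual_lt g2 d0; exists s0 => s us ss.
have := hs0 s us ss; have h2 := residual_L2I s g2.
rewrite -innerI_sumr//; last by move=> k; exact: anti_basis_L2I.
rewrite -(innerIBr f2 g2 (fourier_sum_L2I s g)).
rewrite ltr_pdivlMr; last by lra.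
move=> H; have := cauchy_schwarz f2 h2; have := normsq_ge0 h2 => H0 CS.
rewrite -(@ltr_pXn2r _ 2)// ?nnegrE ?normc_ge0 ?ltW//.
apply: (le_lt_trans CS); apply: le_lt_trans H.
by rewrite mulrDr mulr1 mulrC lerDl.
Qed.

(** Passes from duplicate-free lists to the filter of finite sets ordered by inclusion. *)
Lemma csum_eq (a : int -> R[i]) (L : R[i]) :
  (forall e : R, 0 < e -> exists s0 : seq int, forall s, uniq s ->
    {subset s0 <= s} -> normc (L - \sum_(k <- s) a k) < e) ->
  csum a = L.
Proof.
move=> H; rewrite /csum /summability.sum; apply: (@cvg_lim R[i]^o) => //.
  exact: summability.totally_filter.
have FF : ProperFilter (@summability.totally int) by exact: summability.totally_filter.
(* In the order of [R[i]], [0 < e] says that [e] is real and positive. *)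
apply/(@cvgrPdist_lt R[i] R[i]^o) => e; rewrite ltcE => /andP[/eqP/= e2 e1].
have [s0 hs0] := H _ e1.
exists (finmap.seq_fset tt s0) => // B sB.
rewrite /summability.partial_sum -(finmap.big_seq_fsetE _ B xpredT a)/=.
have := hs0 _ (finmap.fset_uniq B).
have sub : {subset s0 <= finmap.enum_fset B}.
  have /finmap.fsubsetP sB' : finmap.fsubset (finmap.seq_fset tt s0) B := sB.
  by move=> k ks; apply: sB'; rewrite finmap.seq_fsetE.
move=> /(_ sub) lt_e.
have -> : e = (Re e)%:C by case: (e) e2 => ? ? /= ->.
by change ((normc (L - \sum_(k <- finmap.enum_fset B) a k))%:C < (Re e)%:C); rewrite ltcR.
Qed.

End Parseval.

(** * The antiperiodic kernel and its Fourier coefficients *)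

Section Convolution.
Context (R : realType).
Notation I := (@Idom R).
Notation normc := ComplexField.Normc.normc.
Notation Re := (@complex.Re R).
Notation Im := (@complex.Im R).
Notation e_ := (@anti_basis R).
Implicit Types (C u Ch : R -> R[i]).

(** The product on the right carries the normalization twice; [Num.sqrt 2] removes one of the two
    factors. *)
Lemma anti_basisB k x z : e_ k (x - z) = (Num.sqrt 2)%:C * e_ k x * conjc (e_ k z).
Proof.
have s2 := sqrt2_neq0 R.
rewrite /anti_basis conjcM conjc_real conj_expi.
rewrite (_ : pi * (k%:~R + 2^-1) * (x - z) =
  pi * (k%:~R + 2^-1) * x + - (pi * (k%:~R + 2^-1) * z)); last by ring.
rewrite expiD mulrA -rmorphM/= divff// mul1r.
by rewrite mulrCA.
Qed.

Lemma anti_basis_antiperiodic k x : e_ k (x + 2) = - e_ k x.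
Proof.
rewrite /anti_basis -mulrN; congr (_ * _).
(* The increment of the phase is [k] full turns plus [pi], and the half turn gives the sign. The
   form [0 + 2] is what [expi_int_periodic] rewrites. *)
rewrite (_ : pi * (k%:~R + 2^-1) * (x + 2) =
  pi * (k%:~R + 2^-1) * x + pi * k%:~R * (0 + 2) + pi); last by field.
rewrite (expiD _ pi) expiD expi_int_periodic mulr0 expi0 mulr1.
by rewrite {2}/expi cospi sinpi (_ : (-1 +i* 0) = -1) ?mulrN1//; simpc.
Qed.

Lemma cmeasurable_antiperiodic C Ch : L2I C -> antiperiodic_extension C Ch ->
  cmeasurable I Ch.
Proof.
move=> [[m1 m2] _] [E _]; split.
  by apply: (eq_measurable_fun (fun y => Re (C y))) => // y /E ->.
by apply: (eq_measurable_fun (fun y => Im (C y))) => // y /E ->.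
Qed.

(* Multiplying by an antiperiodic exponential turns Ch into a periodic function. *)
Lemma antiperiodic_reflect_L2I C Ch x : x \in I -> L2I C ->
  antiperiodic_extension C Ch -> L2I (fun y => Ch (x - y)).
Proof.
move=> xI C2 hCh; have mCh := cmeasurable_antiperiodic C2 hCh.
have [E Chp] := hCh.
split.
  have mF : cmeasurable I (fun z => Ch z * conjc (e_ 0 z)).
    by apply: cmeasurableM => //; have [] := L2IJ (anti_basis_L2I R 0).
  have Fp z : Ch (z + 2) * conjc (e_ 0 (z + 2)) = Ch z * conjc (e_ 0 z).
    by rewrite Chp anti_basis_antiperiodic rmorphN/= mulrNN.
  (* The second factor equals [2 * e_ 0 (x - y)], the inverse of [conjc (e_ 0 (x - y))], so the
     product is [Ch (x - y)]. *)
  have := cmeasurableM (cmeasurable_periodic_reflect xI mF Fp)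
    (proj1 (L2IZ (2 * e_ 0 x * (Num.sqrt 2)%:C) (L2IJ (anti_basis_L2I R 0)))).
  congr cmeasurable; apply/funext => y.
  have ringE (a b p w r : R[i]) : a * b * (2 * p * w * r) = a * (2 * (b * (w * p * r))).
    by ring.
  rewrite ringE -anti_basisB conj_anti_basisM subrr mulr0 mul0r expi0 mulr1.
  by rewrite (_ : 2 * (2^-1)%:C = 1) ?mulr1//; simpc; congr Complex; field.
have mn : measurable_fun I (fun y => (normc (Ch y) ^+ 2)%:E).
  under eq_fun do rewrite sqr_normc.
  by apply/measurable_EFinP; apply: measurable_funD; apply: measurable_funX;
    case: mCh.
have np z : (normc (Ch (z + 2)) ^+ 2)%:E = (normc (Ch z) ^+ 2)%:E.
  by rewrite Chp !sqr_normc; case: (Ch z) => a b /=; rewrite !sqrrN.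
rewrite (integral_periodic_reflect xI mn np).
apply: le_lt_trans C2.2; rewrite le_eqVlt; apply/orP; left; apply/eqP.
by apply: eq_integral => y yI; rewrite E.
Qed.

Lemma conj_conjc (z : R[i]) : Num.conj (conjc z) = z.
Proof. exact: conjcK. Qed.

Lemma innerI_reflect_anti_basis C Ch x k : x \in I -> L2I C ->
  antiperiodic_extension C Ch ->
  innerI (fun y => conjc (Ch (x - y))) (e_ k) =
  (Num.sqrt 2)%:C * (innerI (e_ k) C * e_ k x).
Proof.
move=> xI C2 hCh; have mCh := cmeasurable_antiperiodic C2 hCh.
have [E Chp] := hCh.
(* Writing [y = x - (x - y)] in [e_ k y] shows that the integrand is [F (x - y)]. As a product of
   two antiperiodic functions, [F] is 2-periodic. *)
pose F z := (Num.sqrt 2)%:C * e_ k x * (conjc (e_ k z) * Ch z).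
have mF : cmeasurable I F.
  have [m1 m2] : cmeasurable I (fun z => conjc (e_ k z) * Ch z).
    by apply: cmeasurableM => //; have [] := L2IJ (anti_basis_L2I R k).
  split; rewrite /F.
    by under eq_fun do rewrite ReM; apply: measurable_funB; apply: measurable_funM.
  by under eq_fun do rewrite ImM; apply: measurable_funD; apply: measurable_funM.
have Fp z : F (z + 2) = F z.
  by rewrite /F Chp anti_basis_antiperiodic rmorphN/= mulrNN.
rewrite (_ : innerI _ _ = cintegral I (fun y => F (x - y))); last first.
  apply: eq_cintegral => y _; rewrite conj_conjc /F [RHS]mulrA -(anti_basisB k x (x - y)).
  by rewrite subKr mulrC.
rewrite cintegral_periodic_reflect// /F.
rewrite (_ : cintegral _ _ = cintegral I (fun y =>
    (Num.sqrt 2)%:C * e_ k x * (conjc (e_ k y) * C y))); last first.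
  by apply: eq_cintegral => y Iy; rewrite E// inE.
rewrite cintegralZ; first by rewrite -mulrA [e_ k x * _]mulrC.
exact: cintegrableM (L2IJ (anti_basis_L2I R k)) C2.
Qed.

(** Since [e_ k x] has modulus [1 / sqrt 2], at most 1, and [p * q <= p ^+ 2 + q ^+ 2], Bessel's
    inequality for [C] and for [u] bounds every finite sum. *)
Lemma abs_summable_conv_term C u x : L2I C -> L2I u ->
  abs_summable (conv_term e_ C u x).
Proof.
move=> C2 u2; rewrite /abs_summable /summable.
apply: (@le_lt_trans _ _ (normsq C + normsq u)%:E); last exact: ltry.
apply: ub_ereal_sup => _ [A [finA _] <-].
rewrite fsbig_finite//.
rewrite (eq_bigr (fun k => (normc (conv_term e_ C u x k))%:E)); last first.
  by move=> k _; rewrite gee0_abs// lee_fin normc_ge0.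
rewrite sumEFin lee_fin.
have := lerD (bessel C2 (finmap.fset_uniq (fset_set A))) (bessel u2 (finmap.fset_uniq (fset_set A))).
rewrite -big_split; apply: le_trans; apply: ler_sum => k _.
rewrite /conv_term (normcM _ (e_ k x)) (normcM (innerI _ C)).
have -> : normc (e_ k x) = (Num.sqrt 2)^-1.
  rewrite normcM normc_expi mulr1 /= expr0n addr0 sqrtr_sqr.
  by rewrite ger0_norm// invr_ge0.
set p := normc _; set q := normc _.
have s1 : (Num.sqrt 2)^-1 <= 1 :> R.
  by rewrite invf_le1 ?sqrtr_gt0// -[leLHS]sqrtr1 ler_wsqrtr// ler1n.
have p0 : 0 <= p * q by rewrite mulr_ge0 ?normc_ge0.
apply: (@le_trans _ _ (p * q)); first by rewrite ler_piMr.
have : p * q <= p ^+ 2 + q ^+ 2 by have := sqr_ge0 (p - q); nra.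
exact.
Qed.

End Convolution.

Theorem mainTheorem14 (R : realType) (C u Ch : R -> R[i])
    (hC : L2I C) (hu : L2I u) (hCh : antiperiodic_extension C Ch)
    (x : R) (hx : x \in @Idom R) :
  [/\ abs_summable (conv_term (@anti_basis R) C u x),
      cintegrable (@Idom R) (fun y => Ch (x - y) * u y) &
      conv (@anti_basis R) C u x =
        ((Num.sqrt 2)^-1)%:C * cintegral (@Idom R) (fun y => Ch (x - y) * u y)].
Proof.
have Ch2 := antiperiodic_reflect_L2I hx hC hCh.
have g2 := L2IJ Ch2.
have gE : innerI (fun y => conjc (Ch (x - y))) u =
    cintegral (@Idom R) (fun y => Ch (x - y) * u y).
  by apply: eq_cintegral => y _; rewrite conj_conjc.
split; [exact: abs_summable_conv_term|exact: cintegrableM|].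
apply: csum_eq => e e0.
have [s0 hs0] := parseval g2 hu e0; exists s0 => s us ss.
(* The error here is [1 / sqrt 2], at most 1, times the error in Parseval's identity, so the same
   [s0] serves. *)
apply: le_lt_trans (hs0 s us ss); rewrite -gE.
have -> : \sum_(k <- s) conv_term (@anti_basis R) C u x k =
    ((Num.sqrt 2)^-1)%:C * \sum_(k <- s) innerI (@anti_basis R k) u *
      innerI (fun y => conjc (Ch (x - y))) (@anti_basis R k).
  rewrite mulr_sumr; apply: eq_bigr => k _.
  rewrite (innerI_reflect_anti_basis k hx hC hCh).
  (* Used with [w] the factor [sqrt 2] of the kernel's coefficients and [w'] its inverse. *)
  have cancel (a b z w w' : R[i]) : w' * w = 1 -> a * b * z = w' * (b * (w * (a * z))).
    move=> ww; rewrite (_ : w' * _ = w' * w * (a * b * z)); last by ring.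
    by rewrite ww mul1r.
  by apply: cancel; rewrite -rmorphM/= mulVf ?sqrt2_neq0.
rewrite -mulrBr normcM ler_piMl ?normc_ge0//.
rewrite /= expr0n addr0 sqrtr_sqr ger0_norm ?invr_ge0//.
by rewrite invf_le1 ?sqrtr_gt0// -[leLHS]sqrtr1 ler_wsqrtr// ler1n.
Qed.
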